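(* Under the standing assumptions below, suppose $\pi\in\ell^\infty$ and $\Phi$ spatially exponentially decays. Then $k(-a)\in\ell^1$ (here $-a=(-a_n)\in c_H$), and the system $\dot x(t)=T_{k(-a)}x(t)$ with state space $X$ satisfies: 1. if $X=c_0$ or $X=\ell^p$ with $1\le p<\infty$, the system is asymptotically stable; 2. if $X=\ell^\infty$ or $X=c$, the system is stable but not asymptotically stable.
   Context: $X$ is one of $\ell^p$ ($1\le p\le\infty$), $c$, $c_0$. Standing assumptions: $a=(a_n)$ strictly decreasing positive reals with $a_n\to0$; $b=(b_n)\in X$, $b_n\ne0$ for all $n$. $A:X\to X$ is $(x_n)\mapsto(a_nx_n)$; for $k=(k_n)$ defining a bounded functional $x\mapsto\sum k_nx_n$, $T_k:=A+bk$, $x\mapsto Ax+(kx)b$. For $\lambda$ with $\operatorname{re}\lambda_n\le0$, $\lambda_n\to0$: $k_n(\lambda):=-\frac{a_n-\lambda_n}{b_n}\prod_{m\neq n}\frac{1-\lambda_m/a_n}{1-a_m/a_n}$; in particular $k_n(-a)=-a_n\pi_n/b_n$ where $$\pi_n:=2\prod_{m\ge1,\,m\ne n}\frac{1+a_m/a_n}{1-a_m/a_n}.$$ $\Phi=[\phi_{ij}]_{i,j\ge1}$ with $\phi_{ij}:=\frac{|b_i/b_j|}{1+a_i/a_j}$. $\Phi$ spatially exponentially decays if there are $C>0$, $\mu\in(0,1)$ with $\phi_{ij}\le C\mu^{|i-j|}$ for all $i,j$. The system $\dot x=T_kx$ is stable if there is $C>0$ with $\|x(t)\|_X\le C\|x(0)\|_X$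 for all $t\ge0$ and all initial conditions; asymptotically stable if stable and $x(t)\to0$ in $X$ for every $x(0)\in X$. *)

(* Defs.v *)
From Stdlib Require Import Reals Lra.
From Coquelicot Require Import Coquelicot.
Open Scope R_scope.

Inductive space := Lp (p : R) | Linf | Cc | C0.

Definition valid_space (X : space) : Prop :=
  match X with Lp p => 1 <= p | _ => True end.

Definition rpow (x p : R) : R := if Rle_dec x 0 then 0 else Rpower x p.

Definition bounded_seq (u : nat -> C) : Prop :=
  exists M, forall n, Cmod (u n) <= M.

Definition cconv (u : nat -> C) (l : C) : Prop :=
  is_lim_seq (fun n => Cmod (Cminus (u n) l)) 0.

Definition inX (X : space) (u : nat -> C) : Prop :=
  match X with
  | Lp p => ex_series (fun n => rpow (Cmod (u n)) p)
  | Linf => bounded_seq u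
  | Cc => exists l, cconv u l
  | C0 => cconv u 0
  end.

Definition supnorm (u : nat -> C) : R := real (Sup_seq (fun n => Cmod (u n))).

Definition normX (X : space) (u : nat -> C) : R :=
  match X with
  | Lp p => rpow (Series (fun n => rpow (Cmod (u n)) p)) (/ p)
  | _ => supnorm u
  end.

Definition standing (X : space) (a : nat -> R) (b : nat -> C) : Prop :=
  (forall n, a (S n) < a n) /\ (forall n, 0 < a n) /\ is_lim_seq a 0 /\
  inX X b /\ (forall n, b n <> RtoC 0).

Definition pi_factor (a : nat -> R) (n m : nat) : R :=
  (1 + a m / a n) / (1 - a m / a n).

Fixpoint pi_partial (a : nat -> R) (n N : nat) : R :=
  match N with
  | O => 2
  | S N' => pi_partial a n N' * (if Nat.eq_dec N' n then 1 else pi_factor a n N')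
  end.

Definition pi_seq (a : nat -> R) (n : nat) : R := real (Lim_seq (pi_partial a n)).

Definition pi_in_linf (a : nat -> R) : Prop :=
  (forall n, ex_finite_lim_seq (pi_partial a n)) /\
  exists M, forall n, Rabs (pi_seq a n) <= M.

Definition natdist (i j : nat) : nat := ((i - j) + (j - i))%nat.

Definition phi (a : nat -> R) (b : nat -> C) (i j : nat) : R :=
  Cmod (Cdiv (b i) (b j)) / (1 + a i / a j).

Definition spatially_exp_decays (a : nat -> R) (b : nat -> C) : Prop :=
  exists Cst mu, 0 < Cst /\ 0 < mu < 1 /\
    forall i j, phi a b i j <= Cst * mu ^ (natdist i j).

Definition k_ma (a : nat -> R) (b : nat -> C) (n : nat) : C :=
  Cdiv (RtoC (- a n * pi_seq a n)) (b n).

Definition in_l1 (k : nat -> C) : Prop := ex_series (fun n => Cmod (k n)).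

Definition csum (u : nat -> C) : C :=
  (Series (fun n => Re (u n)), Series (fun n => Im (u n))).

Definition Tk (a : nat -> R) (b k : nat -> C) (x : nat -> C) : nat -> C :=
  fun n => Cplus (Cmult (RtoC (a n)) (x n))
                 (Cmult (csum (fun m => Cmult (k m) (x m))) (b n)).

(* x : [0,oo) -> X is a (classical) solution: x(t) in X and
   x is differentiable in the norm of X with derivative T x(t)
   (one-sided at t = 0). *)
Definition solution (X : space) (T : (nat -> C) -> (nat -> C)) (x : R -> nat -> C) : Prop :=
  (forall t, 0 <= t -> inX X (x t)) /\
  forall t, 0 <= t -> forall eps, 0 < eps -> exists delta, 0 < delta /\
    forall h, h <> 0 -> Rabs h < delta -> 0 <= t + h ->
      let r := fun n => Cminus (Cdiv (Cminus (x (t + h) n) (x t n)) (RtoC h)) (T (x t) n) in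
      inX X r /\ normX X r < eps.

Definition stable (X : space) (T : (nat -> C) -> (nat -> C)) : Prop :=
  (forall x0, inX X x0 -> exists x, solution X T x /\ x 0 = x0) /\
  exists Cst, 0 < Cst /\
    forall x, solution X T x -> forall t, 0 <= t -> normX X (x t) <= Cst * normX X (x 0).

Definition asym_stable (X : space) (T : (nat -> C) -> (nat -> C)) : Prop :=
  stable X T /\
  forall x, solution X T x ->
    forall eps, 0 < eps -> exists t0, forall t, t0 <= t -> normX X (x t) < eps.

(* Main.v *)
(** Put [J n m = (b n / b m) a_m pi_m / (a_n + a_m)].  The partial fraction expansion
    of [prod_m (z + a_m) / (z - a_m)], finite first and then in the limit by Tannery's theorem,
    gives [sum_n a_n pi_n / (a_n + a_m) = 1] and [J^2 = I].  The first identity yields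
    [J T = - A J], hence [T = - J A J] and the solutions are [J e^(-tA) J x0].
    Since [|J n m| = phi n m |pi_m|] decays exponentially off the diagonal, [J] is bounded on
    l^p, c_0 and l^oo by Schur's test, which gives stability; [e^(-tA)] tends strongly to 0 on l^p
    and c_0.  On c and l^oo, [x(t) - x0] stays in c_0, so the solution started at the constant
    sequence 1 does not tend to 0. *)

Require Import Defs.
From Stdlib Require Import Reals Lra Lia Compare_dec FunctionalExtensionality.
From Coquelicot Require Import Coquelicot.
Open Scope R_scope.

(** * Series *)

(** [J] is the solution of the Sylvester equation [J A + A J = - b k]: dividing [- b_n k_m] by
    [a_n + a_m] gives its entries. The identity [J b = b] then absorbs the rank-one part of [T], so
    [T] is similar to [- A] through a map that is its own inverse.

    The limit in the finite identities needs a summable majorant, while [a] is only assumed to tend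
    to 0. Its summability comes from the decay of [Phi] on both sides of the diagonal: in
    [phi 0 j * phi j 0] the quotients of [b] cancel and leave [a_j] up to bounded factors.

    The space c resists direct estimates, because shrinking the moduli of a convergent sequence can
    destroy convergence. There the norm bounds are taken in l^oo, and convergence is recovered
    because [e^(-tA) - I] and the error of the difference quotient carry a factor [a_n]: both map
    bounded sequences into c_0, which [J] preserves. *)

Lemma bounded_sums_Series (u : nat -> R) (M : R) :
  (forall n, 0 <= u n) -> (forall N, sum_f_R0 u N <= M) -> ex_series u /\ Series u <= M.
Proof.
  intros Hu HM.
  assert (E : ex_finite_lim_seq (sum_n u)).
  { apply ex_finite_lim_seq_incr with M; intro n.
    - rewrite sum_Sn. unfold plus; simpl. specialize (Hu (S n)). lra.
    - rewrite sum_n_Reals. apply HM. }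
  assert (Ex : ex_series u) by (destruct E as [l Hl]; exists l; exact Hl).
  split; [exact Ex|].
  apply Series_correct in Ex.
  apply (is_lim_seq_le (sum_n u) (fun _ => M) (Series u) M).
  - intro n. rewrite sum_n_Reals. apply HM.
  - exact Ex.
  - apply is_lim_seq_const.
Qed.

Lemma sum_le_Series (u : nat -> R) (N : nat) :
  (forall n, 0 <= u n) -> ex_series u -> sum_f_R0 u N <= Series u.
Proof.
  intros Hu Ex. apply Series_correct in Ex.
  rewrite <- sum_n_Reals.
  apply (is_lim_seq_incr_compare (sum_n u) (Series u)); [exact Ex|].
  intro n. rewrite sum_Sn. unfold plus; simpl. specialize (Hu (S n)). lra.
Qed.

Lemma Series_nonneg (u : nat -> R) : (forall n, 0 <= u n) -> ex_series u -> 0 <= Series u.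
Proof.
  intros Hu Ex. apply Rle_trans with (sum_f_R0 u 0); [apply Hu|now apply sum_le_Series].
Qed.

Lemma term_le_Series (u : nat -> R) (n : nat) :
  (forall n, 0 <= u n) -> ex_series u -> u n <= Series u.
Proof.
  intros Hu Ex. apply Rle_trans with (sum_f_R0 u n); [|now apply sum_le_Series].
  destruct n; simpl; [lra|]. pose proof (cond_pos_sum u n Hu). lra.
Qed.

Lemma ex_series_dom (u v : nat -> R) :
  (forall n, 0 <= u n <= v n) -> ex_series v -> ex_series u.
Proof.
  intros H Ex. apply (@ex_series_le R_AbsRing R_CompleteNormedModule u v); [|exact Ex].
  intro n. change (Rabs (u n) <= v n). rewrite Rabs_pos_eq; apply H.
Qed.

Lemma ex_series_scalR (c : R) (u : nat -> R) : ex_series u -> ex_series (fun n => c * u n).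
Proof. intro H. exact (ex_series_scal (K := R_AbsRing) (V := R_NormedModule) c u H). Qed.

Lemma ex_series_plusR (u v : nat -> R) :
  ex_series u -> ex_series v -> ex_series (fun n => u n + v n).
Proof. exact (ex_series_plus u v). Qed.

Lemma sum_lim0 (h : nat -> nat -> R) (K : nat) :
  (forall n, is_lim_seq (fun N => h N n) 0) -> is_lim_seq (fun N => sum_f_R0 (h N) K) 0.
Proof.
  intro H. induction K as [|K IH]; simpl; [apply H|].
  replace (Finite 0) with (Finite (0 + 0)) by (f_equal; ring).
  now apply is_lim_seq_plus'.
Qed.

(** Dominated convergence for series: a cut-off [K] makes the tail of [g], hence every tail of
    [h N], smaller than [eps / 2]; what remains is a finite sum of null sequences. *)
Lemma dominated_Series_lim0 (h : nat -> nat -> R) (g : nat -> R) :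
  ex_series g -> (forall N n, 0 <= h N n <= g n) ->
  (forall n, is_lim_seq (fun N => h N n) 0) -> is_lim_seq (fun N => Series (h N)) 0.
Proof.
  intros Eg Hh Hl. apply is_lim_seq_spec. intro eps.
  assert (Gs := Series_correct _ Eg).
  assert (Gl : is_lim_seq (sum_n g) (Series g)) by exact Gs.
  apply is_lim_seq_spec in Gl.
  assert (e2 : 0 < eps / 2) by (destruct eps; simpl; lra).
  destruct (Gl (mkposreal _ e2)) as [K HK]. specialize (HK K (le_n _)). simpl in HK.
  pose proof (sum_lim0 h K Hl) as Hs. apply is_lim_seq_spec in Hs.
  destruct (Hs (mkposreal _ e2)) as [N0 HN]. exists N0. intros N HNN.
  specialize (HN N HNN). simpl in HN.
  assert (Eh : ex_series (h N)) by (apply ex_series_dom with g; auto).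
  assert (Pg : ex_series (fun k => g (S K + k)%nat)) by (now apply ex_series_incr_n).
  rewrite sum_n_Reals in HK.
  rewrite (Series_incr_n g (S K)) in HK by (auto; lia).
  rewrite (Series_incr_n (h N) (S K)) by (auto; lia).
  simpl Init.Nat.pred in *.
  assert (Series (fun k => h N (S K + k)%nat) <= Series (fun k => g (S K + k)%nat))
    by (apply Series_le; auto).
  assert (0 <= Series (fun k => h N (S K + k)%nat)).
  { apply Series_nonneg; [intro; apply Hh|]. now apply ex_series_incr_n. }
  assert (0 <= sum_f_R0 (h N) K) by (apply cond_pos_sum; intro; apply Hh).
  rewrite Rminus_0_r in *.
  apply Rabs_def2 in HK. apply Rabs_def2 in HN. apply Rabs_def1; lra.
Qed.

(** The bound by [g] passes to the limit [l], so [Rabs (f N n - l n)] is dominated by [2 * g n] and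
    its series tends to 0. *)
Lemma tannery (f : nat -> nat -> R) (l g : nat -> R) :
  ex_series g -> (forall N n, Rabs (f N n) <= g n) ->
  (forall n, is_lim_seq (fun N => f N n) (l n)) ->
  ex_series l /\ is_lim_seq (fun N => Series (f N)) (Series l).
Proof.
  intros Eg Hf Hl.
  assert (Bl : forall n, Rabs (l n) <= g n).
  { intro n. apply (is_lim_seq_le (fun N => Rabs (f N n)) (fun _ => g n) (Rabs (l n)) (g n)).
    - intro; apply Hf.
    - apply (is_lim_seq_abs _ (l n)), Hl.
    - apply is_lim_seq_const. }
  assert (Ef : forall N, ex_series (f N)).
  { intro N. apply (@ex_series_le R_AbsRing R_CompleteNormedModule (f N) g); auto. }
  assert (El : ex_series l).
  { apply (@ex_series_le R_AbsRing R_CompleteNormedModule l g); auto. }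
  split; [exact El|].
  assert (D : is_lim_seq (fun N => Series (fun n => Rabs (f N n - l n))) 0).
  { apply dominated_Series_lim0 with (fun n => 2 * g n).
    - now apply ex_series_scalR.
    - intros N n. split; [apply Rabs_pos|].
      specialize (Hf N n). specialize (Bl n).
      pose proof (Rabs_triang (f N n) (- l n)). rewrite Rabs_Ropp in H.
      unfold Rminus. lra.
    - intro n. apply -> is_lim_seq_abs_0.
      replace (Finite 0) with (Finite (l n - l n)) by (f_equal; ring).
      apply is_lim_seq_minus'; [apply Hl|apply is_lim_seq_const]. }
  assert (D2 : is_lim_seq (fun N => Series (f N) - Series l) 0).
  { apply is_lim_seq_abs_0.
    apply is_lim_seq_le_le with (fun _ => 0) (fun N => Series (fun n => Rabs (f N n - l n))).
    - intro N. split; [apply Rabs_pos|].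
      rewrite <- Series_minus by auto. apply Series_Rabs.
      apply ex_series_dom with (fun n => 2 * g n).
      + intro n. split; [apply Rabs_pos|]. specialize (Hf N n). specialize (Bl n).
        pose proof (Rabs_triang (f N n) (- l n)). rewrite Rabs_Ropp in H.
        unfold Rminus. lra.
      + now apply ex_series_scalR.
    - apply is_lim_seq_const.
    - exact D. }
  apply is_lim_seq_ext with (fun N => (Series (f N) - Series l) + Series l); [intro; ring|].
  replace (Finite (Series l)) with (Finite (0 + Series l)) by (f_equal; ring).
  apply is_lim_seq_plus'; [exact D2|apply is_lim_seq_const].
Qed.

(** * Complex absolutely convergent sums *)

Definition asum (u : nat -> C) : Prop := ex_series (fun n => Cmod (u n)).

Lemma im_le_Cmod (z : C) : Rabs (Im z) <= Cmod z.
Proof. eapply Rle_trans; [apply Rmax_r|apply Rmax_Cmod]. Qed.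

Lemma Cmod_le_Re_Im (z : C) : Cmod z <= Rabs (Re z) + Rabs (Im z).
Proof.
  rewrite <- (Rabs_pos_eq (Rabs (Re z) + Rabs (Im z))).
  2:{ pose proof (Rabs_pos (Re z)); pose proof (Rabs_pos (Im z)); lra. }
  unfold Cmod. rewrite <- sqrt_Rsqr_abs. apply sqrt_le_1_alt.
  fold (Re z) (Im z). unfold Rsqr.
  pose proof (Rabs_pos (Re z)); pose proof (Rabs_pos (Im z)).
  pose proof (pow2_abs (Re z)); pose proof (pow2_abs (Im z)). nra.
Qed.

Lemma asum_Re (u : nat -> C) : asum u -> ex_series (fun n => Re (u n)).
Proof.
  intro H. apply (@ex_series_le R_AbsRing R_CompleteNormedModule _ (fun n => Cmod (u n))); auto.
  intro n. apply re_le_Cmod.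
Qed.

Lemma asum_Im (u : nat -> C) : asum u -> ex_series (fun n => Im (u n)).
Proof.
  intro H. apply (@ex_series_le R_AbsRing R_CompleteNormedModule _ (fun n => Cmod (u n))); auto.
  intro n. apply im_le_Cmod.
Qed.

Lemma asum_dom (u : nat -> C) (g : nat -> R) :
  ex_series g -> (forall n, Cmod (u n) <= g n) -> asum u.
Proof.
  intros Eg H. apply ex_series_dom with g; auto.
  intro n; split; [apply Cmod_ge_0|apply H].
Qed.

Lemma asum_scal (c : C) (u : nat -> C) : asum u -> asum (fun n => (c * u n)%C).
Proof.
  intro H. apply asum_dom with (fun n => Cmod c * Cmod (u n)).
  - now apply ex_series_scalR.
  - intro n. rewrite Cmod_mult. lra.
Qed.

Lemma csum_ext (u v : nat -> C) : (forall n, u n = v n) -> csum u = csum v.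
Proof. intro H. f_equal. now apply functional_extensionality. Qed.

Lemma csum_plus (u v : nat -> C) :
  asum u -> asum v -> csum (fun n => (u n + v n)%C) = (csum u + csum v)%C.
Proof.
  intros Hu Hv. unfold csum, Cplus; simpl. f_equal.
  - apply Series_plus; now apply asum_Re.
  - apply Series_plus; now apply asum_Im.
Qed.

Lemma csum_scal (c : C) (u : nat -> C) :
  asum u -> csum (fun n => (c * u n)%C) = (c * csum u)%C.
Proof.
  intro Hu. pose proof (asum_Re u Hu). pose proof (asum_Im u Hu).
  unfold csum, Cmult; simpl. f_equal.
  - rewrite Series_minus by (apply ex_series_scalR; assumption).
    now rewrite !Series_scal_l.
  - rewrite Series_plus by (apply ex_series_scalR; assumption).
    now rewrite !Series_scal_l.
Qed.

Lemma csum_RtoC (u : nat -> R) : csum (fun n => RtoC (u n)) = RtoC (Series u).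
Proof.
  unfold csum, RtoC; simpl. f_equal.
  rewrite (Series_ext _ (fun n => 0 * 0)) by (intro; ring).
  rewrite Series_scal_l. ring.
Qed.

(** The squared modulus of the sum [z] is the real part of [Cconj z * z]; moving [Cconj z] inside
    the sum reduces the claim to the real triangle inequality, and one factor [Cmod z] cancels at
    the end. *)
Lemma Cmod_csum (u : nat -> C) : asum u -> Cmod (csum u) <= Series (fun n => Cmod (u n)).
Proof.
  intro Hu. set (z := csum u). set (s := Series (fun n => Cmod (u n))).
  assert (H : Cmod z ^ 2 <= Cmod z * s).
  { replace (Cmod z ^ 2) with (Re (Cconj z * z)%C).
    2:{ rewrite Cmod2_alt. simpl. ring. }
    unfold z at 2. rewrite <- csum_scal by assumption. unfold csum; simpl Re.
    unfold s. rewrite <- Series_scal_l.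
    eapply Rle_trans; [apply Rle_abs|].
    assert (A : forall n, Rabs (Re (Cconj z * u n)%C) <= Cmod z * Cmod (u n)).
    { intro n. eapply Rle_trans; [apply re_le_Cmod|]. rewrite Cmod_mult, Cmod_conj. lra. }
    assert (E : ex_series (fun n => Cmod z * Cmod (u n))) by now apply ex_series_scalR.
    eapply Rle_trans; [apply Series_Rabs|].
    - apply ex_series_dom with (fun n => Cmod z * Cmod (u n)); auto.
      intro n; split; [apply Rabs_pos|apply A].
    - apply Series_le; auto. intro n; split; [apply Rabs_pos|apply A]. }
  assert (0 <= s) by (apply Series_nonneg; auto; intro; apply Cmod_ge_0).
  destruct (Req_dec (Cmod z) 0) as [E|E]; [lra|].
  pose proof (Cmod_ge_0 z). nra.
Qed.

Lemma cconv_Re_Im (u : nat -> C) (l : C) :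
  cconv u l <-> is_lim_seq (fun n => Re (u n)) (Re l) /\ is_lim_seq (fun n => Im (u n)) (Im l).
Proof.
  unfold cconv. split.
  - intro H. split.
    + apply is_lim_seq_ext with (fun n => Re (u n - l)%C + Re l); [intro; unfold Cminus, Cplus, Copp, Re; simpl; ring|].
      replace (Finite (Re l)) with (Finite (0 + Re l)) by (f_equal; ring).
      apply is_lim_seq_plus'; [|apply is_lim_seq_const]. apply <- is_lim_seq_abs_0.
      apply is_lim_seq_le_le with (fun _ => 0) (fun n => Cmod (u n - l)%C); auto.
      * intro n; split; [apply Rabs_pos|apply re_le_Cmod].
      * apply is_lim_seq_const.
    + apply is_lim_seq_ext with (fun n => Im (u n - l)%C + Im l); [intro; unfold Cminus, Cplus, Copp, Im; simpl; ring|].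
      replace (Finite (Im l)) with (Finite (0 + Im l)) by (f_equal; ring).
      apply is_lim_seq_plus'; [|apply is_lim_seq_const]. apply <- is_lim_seq_abs_0.
      apply is_lim_seq_le_le with (fun _ => 0) (fun n => Cmod (u n - l)%C); auto.
      * intro n; split; [apply Rabs_pos|apply im_le_Cmod].
      * apply is_lim_seq_const.
  - intros [H1 H2].
    apply is_lim_seq_le_le with (fun _ => 0) (fun n => Rabs (Re (u n) - Re l) + Rabs (Im (u n) - Im l)).
    + intro n; split; [apply Cmod_ge_0|]. exact (Cmod_le_Re_Im (u n - l)%C).
    + apply is_lim_seq_const.
    + replace (Finite 0) with (Finite (Rabs (Re l - Re l) + Rabs (Im l - Im l)))
        by (rewrite !Rminus_diag, Rabs_R0; f_equal; ring).
      apply is_lim_seq_plus'; apply (is_lim_seq_abs _ (Finite _)), is_lim_seq_minus';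
        auto; apply is_lim_seq_const.
Qed.

Lemma tannery_C (f : nat -> nat -> C) (l : nat -> C) (g : nat -> R) :
  ex_series g -> (forall N n, Cmod (f N n) <= g n) ->
  (forall n, cconv (fun N => f N n) (l n)) -> cconv (fun N => csum (f N)) (csum l).
Proof.
  intros Eg Hf Hl. apply cconv_Re_Im. split; simpl.
  - apply (tannery (fun N n => Re (f N n)) (fun n => Re (l n)) g); auto.
    + intros N n. eapply Rle_trans; [apply re_le_Cmod|apply Hf].
    + intro n. now apply (proj1 (cconv_Re_Im (fun N => f N n) _) (Hl n)).
  - apply (tannery (fun N n => Im (f N n)) (fun n => Im (l n)) g); auto.
    + intros N n. eapply Rle_trans; [apply im_le_Cmod|apply Hf].
    + intro n. now apply (proj1 (cconv_Re_Im (fun N => f N n) _) (Hl n)).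
Qed.

Lemma cconv_unique (u : nat -> C) (l l' : C) : cconv u l -> cconv u l' -> l = l'.
Proof.
  intros H H'. apply cconv_Re_Im in H, H'. destruct H as [A B], H' as [A' B'].
  apply is_lim_seq_unique in A, B, A', B'. rewrite A in A'. rewrite B in B'.
  injection A' as A'. injection B' as B'. destruct l, l'; simpl in *; now subst.
Qed.

(** * The powers [rpow] and the norms *)

Lemma rpow_ge0 (x p : R) : 0 <= rpow x p.
Proof. unfold rpow. destruct (Rle_dec x 0); [lra|left; apply exp_pos]. Qed.

Lemma rpow_0 (p : R) : rpow 0 p = 0.
Proof. unfold rpow. destruct (Rle_dec 0 0); lra. Qed.

Lemma rpow_pos (x p : R) : 0 < x -> rpow x p = Rpower x p.
Proof. intro H. unfold rpow. destruct (Rle_dec x 0); [lra|reflexivity]. Qed.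

Lemma rpow_le (x y p : R) : 0 <= p -> x <= y -> rpow x p <= rpow y p.
Proof.
  intros Hp H. unfold rpow at 1. destruct (Rle_dec x 0); [apply rpow_ge0|].
  rewrite rpow_pos by lra. apply Rle_Rpower_l; lra.
Qed.

Lemma rpow_lt (x y p : R) : 0 < p -> 0 <= x < y -> rpow x p < rpow y p.
Proof.
  intros Hp H. rewrite (rpow_pos y) by lra. unfold rpow. destruct (Rle_dec x 0).
  - apply exp_pos.
  - apply Rlt_Rpower_l; lra.
Qed.

Lemma rpow_mult (x y p : R) : 0 <= x -> 0 <= y -> rpow (x * y) p = rpow x p * rpow y p.
Proof.
  intros [Hx|<-] [Hy|<-]; rewrite ?Rmult_0_l, ?Rmult_0_r, ?rpow_0, ?Rmult_0_l, ?Rmult_0_r; auto.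
  rewrite !rpow_pos by (try apply Rmult_lt_0_compat; lra). now rewrite Rpower_mult_distr.
Qed.

Lemma rpow_rpow_inv (x p : R) : 0 <= x -> 0 < p -> rpow (rpow x p) (/ p) = x.
Proof.
  intros [Hx|<-] Hp; [|now rewrite !rpow_0].
  rewrite (rpow_pos x) by auto. rewrite rpow_pos by apply exp_pos.
  rewrite Rpower_mult, Rinv_r, Rpower_1; lra.
Qed.

(* Young's inequality between exp (p v) and 1, both bounded below by the tangent of exp at v. *)
Lemma rpow_bernoulli (u p : R) : 0 <= u -> 1 <= p -> 1 + p * (u - 1) <= rpow u p.
Proof.
  intros [Hu|<-] Hp; [|rewrite rpow_0; lra].
  rewrite rpow_pos by auto. unfold Rpower. set (v := ln u).
  assert (E : u = exp v) by (symmetry; now apply exp_ln).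
  assert (H1 : exp v * (1 + (p - 1) * v) <= exp (p * v)).
  { replace (p * v) with (v + (p - 1) * v) by ring. rewrite exp_plus.
    apply Rmult_le_compat_l; [left; apply exp_pos|apply exp_ineq1_le]. }
  assert (H2 : exp v * (1 - v) <= 1).
  { replace 1 with (exp v * exp (- v)) at 2 by (rewrite <- exp_plus, Rplus_opp_r; apply exp_0).
    apply Rmult_le_compat_l; [left; apply exp_pos|]. pose proof (exp_ineq1_le (- v)). lra. }
  rewrite E. nra.
Qed.

(** The convex function [x^p] lies above its tangent at [y]: Bernoulli's inequality at [x / y],
    scaled by [y^p]. *)
Lemma rpow_tangent (x y p : R) :
  0 <= x -> 0 < y -> 1 <= p -> rpow y p * (1 - p) + (rpow y p * p / y) * x <= rpow x p.
Proof.
  intros Hx Hy Hp.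
  replace x with (y * (x / y)) at 2 by (field; lra).
  assert (0 <= x / y) by (apply Rdiv_le_0_compat; lra).
  rewrite rpow_mult by lra.
  pose proof (rpow_bernoulli (x / y) p H Hp). pose proof (rpow_ge0 y p).
  replace (rpow y p * (1 - p) + rpow y p * p / y * x)
    with (rpow y p * (1 + p * (x / y - 1))) by (field; lra).
  now apply Rmult_le_compat_l.
Qed.

Lemma cconv_bounded (u : nat -> C) (l : C) : cconv u l -> bounded_seq u.
Proof.
  intro H.
  destruct (filterlim_bounded (K := R_AbsRing) (V := R_NormedModule) (fun n => Cmod (u n - l)%C)) as [M HM].
  { exists 0. exact H. }
  exists (M + Cmod l). intro n. replace (u n) with ((u n - l) + l)%C by ring.
  eapply Rle_trans; [apply Cmod_triangle|]. specialize (HM n).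
  change (Rabs (Cmod (u n - l)%C) <= M) in HM. rewrite Rabs_pos_eq in HM by apply Cmod_ge_0. lra.
Qed.

(** Boundedness excludes the value [p_infty] of [Sup_seq], which [real] would send to 0. *)
Lemma le_supnorm (u : nat -> C) (n : nat) : bounded_seq u -> Cmod (u n) <= supnorm u.
Proof.
  intros [M HM]. unfold supnorm.
  pose proof (Sup_seq_correct (fun n => Cmod (u n))) as H.
  destruct (Sup_seq _) as [s| |]; simpl in *.
  - apply le_epsilon. intros eps He. left. apply (proj1 (H (mkposreal eps He)) n).
  - destruct (H M) as [k Hk]. specialize (HM k). lra.
  - specialize (H (Cmod (u n)) n). lra.
Qed.

Lemma supnorm_le (u : nat -> C) (M : R) : (forall n, Cmod (u n) <= M) -> supnorm u <= M.
Proof.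
  (* [0 <= M] settles the infinite values of [Sup_seq], where [real] returns 0. *)
  intros HM. assert (0 <= M) by (eapply Rle_trans; [apply Cmod_ge_0|apply (HM O)]).
  unfold supnorm. pose proof (Sup_seq_correct (fun n => Cmod (u n))) as Hs.
  destruct (Sup_seq _) as [s| |]; simpl in *; auto.
  apply le_epsilon. intros eps He. destruct (Hs (mkposreal eps He)) as [_ [k Hk]].
  specialize (HM k). simpl in Hk. lra.
Qed.

Lemma Cmod_le_normLp (p : R) (u : nat -> C) (n : nat) :
  1 <= p -> inX (Lp p) u -> Cmod (u n) <= normX (Lp p) u.
Proof.
  intros Hp Hu. simpl in *.
  rewrite <- (rpow_rpow_inv (Cmod (u n)) p) by (try apply Cmod_ge_0; lra).
  apply rpow_le; [left; apply Rinv_0_lt_compat; lra|].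
  apply (term_le_Series (fun n => rpow (Cmod (u n)) p)); auto. intro; apply rpow_ge0.
Qed.

Lemma inX_bounded (X : space) (u : nat -> C) : valid_space X -> inX X u -> bounded_seq u.
Proof.
  destruct X; intros V H; auto.
  - exists (normX (Lp p) u). intro. now apply Cmod_le_normLp.
  - destruct H as [l H]. now apply cconv_bounded with l.
  - now apply cconv_bounded with (RtoC 0).
Qed.

Lemma Cmod_le_normX (X : space) (u : nat -> C) (n : nat) :
  valid_space X -> inX X u -> Cmod (u n) <= normX X u.
Proof.
  intros V H. pose proof (inX_bounded X u V H).
  destruct X; [now apply Cmod_le_normLp|now apply le_supnorm..].
Qed.

Lemma normX_nonneg (X : space) (u : nat -> C) : valid_space X -> inX X u -> 0 <= normX X u.
Proof.
  intros V H. eapply Rle_trans; [apply Cmod_ge_0|apply (Cmod_le_normX X u O V H)].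
Qed.

(** Bounds on partial sums give membership and the norm estimate at once; the bound is factored as
    [c^p * S] so that the p-th root returns [c] as a plain operator constant. *)
Lemma Lp_norm_scal_le (p c S : R) (u : nat -> C) :
  1 <= p -> 0 <= c -> 0 <= S -> (forall N, sum_f_R0 (fun n => rpow (Cmod (u n)) p) N <= rpow c p * S) ->
  inX (Lp p) u /\ normX (Lp p) u <= c * rpow S (/ p).
Proof.
  intros Hp Hc HS H.
  destruct (bounded_sums_Series _ _ (fun n => rpow_ge0 _ p) H) as [E L].
  split; [exact E|]. simpl.
  rewrite <- (rpow_rpow_inv c p) by lra. rewrite <- rpow_mult by (auto; apply rpow_ge0).
  apply rpow_le; auto. left; apply Rinv_0_lt_compat; lra.
Qed.

Lemma cconv0_le (u : nat -> C) (g : nat -> R) :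
  (forall n, Cmod (u n) <= g n) -> is_lim_seq g 0 -> cconv u 0.
Proof.
  intros H Hg. unfold cconv.
  apply is_lim_seq_ext with (fun n => Cmod (u n)); [intro n; f_equal; ring|].
  apply is_lim_seq_le_le with (fun _ => 0) g; auto.
  - intro; split; [apply Cmod_ge_0|apply H].
  - apply is_lim_seq_const.
Qed.

Lemma cconv0_Cmod (u : nat -> C) : cconv u 0 -> is_lim_seq (fun n => Cmod (u n)) 0.
Proof.
  intro H. apply is_lim_seq_ext with (fun n => Cmod (u n - 0)%C); [intro; f_equal; ring|exact H].
Qed.

(** The spaces in which membership depends only on moduli and passes to smaller moduli. In c, a
    sequence dominated by a convergent one may still oscillate. *)
Definition solid (X : space) : Prop := match X with Cc => False | _ => True end.

Lemma solid_le (X : space) (c : R) (u v : nat -> C) :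
  valid_space X -> solid X -> 0 <= c -> inX X v -> (forall n, Cmod (u n) <= c * Cmod (v n)) ->
  inX X u /\ normX X u <= c * normX X v.
Proof.
  intros V Sol Hc Hv Huv.
  assert (B := inX_bounded X v V Hv).
  assert (HS : supnorm u <= c * supnorm v).
  { apply supnorm_le. intro n. eapply Rle_trans; [apply Huv|].
    apply Rmult_le_compat_l; auto. now apply le_supnorm. }
  destruct X as [p| | |]; simpl in V, Sol; try contradiction.
  - apply Lp_norm_scal_le; auto.
    + apply Series_nonneg; auto. intro; apply rpow_ge0.
    + intro N. apply Rle_trans with (rpow c p * sum_f_R0 (fun n => rpow (Cmod (v n)) p) N).
      * rewrite scal_sum. apply sum_Rle. intros n _. rewrite Rmult_comm, <- rpow_mult by (auto; apply Cmod_ge_0).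
        apply rpow_le; [lra|apply Huv].
      * apply Rmult_le_compat_l; [apply rpow_ge0|]. apply sum_le_Series; auto. intro; apply rpow_ge0.
  - split; auto. destruct B as [M HM]. exists (c * M). intro n.
    eapply Rle_trans; [apply Huv|]. now apply Rmult_le_compat_l.
  - split; auto. apply cconv0_le with (fun n => c * Cmod (v n)); auto.
    replace (Finite 0) with (Rbar_mult c 0) by (simpl; f_equal; ring).
    apply is_lim_seq_scal_l. now apply cconv0_Cmod.
Qed.

(** * Matrices with uniformly summable rows and columns *)

Definition kmul (K : nat -> nat -> C) (u : nat -> C) (n : nat) : C :=
  csum (fun m => (K n m * u m)%C).

(** Bounding partial sums, not series, makes summability of rows and columns part of the condition.
    Rows control l^oo, columns control l^1, and both together control l^p. *)
Definition schur (K : nat -> nat -> C) (S : R) : Prop :=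
  (forall n N, sum_f_R0 (fun m => Cmod (K n m)) N <= S) /\
  (forall m N, sum_f_R0 (fun n => Cmod (K n m)) N <= S).

Lemma schur_row (K : nat -> nat -> C) (S : R) (n : nat) :
  schur K S -> asum (K n) /\ Series (fun m => Cmod (K n m)) <= S.
Proof. intros [H _]. apply bounded_sums_Series; auto. intro; apply Cmod_ge_0. Qed.

Lemma schur_col0 (K : nat -> nat -> C) (S : R) (m : nat) :
  schur K S -> is_lim_seq (fun n => Cmod (K n m)) 0.
Proof.
  intros [_ H]. apply ex_series_lim_0.
  apply (bounded_sums_Series (fun n => Cmod (K n m)) S); auto. intro; apply Cmod_ge_0.
Qed.

Lemma kmul_asum (K : nat -> nat -> C) (S : R) (u : nat -> C) (n : nat) :
  schur K S -> bounded_seq u -> asum (fun m => (K n m * u m)%C).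
Proof.
  intros HK [M HM]. apply asum_dom with (fun m => M * Cmod (K n m)).
  - apply ex_series_scalR, (schur_row K S n HK).
  - intro m. rewrite Cmod_mult, Rmult_comm. apply Rmult_le_compat_r; auto. apply Cmod_ge_0.
Qed.

Lemma kmul_Cmod_sum (K : nat -> nat -> C) (S : R) (u : nat -> C) (n : nat) :
  schur K S -> bounded_seq u ->
  Cmod (kmul K u n) <= Series (fun m => Cmod (K n m) * Cmod (u m)).
Proof.
  intros HK HB. eapply Rle_trans; [apply Cmod_csum; now apply kmul_asum with S|].
  right. apply Series_ext. intro; apply Cmod_mult.
Qed.

Lemma kmul_Cmod_le (K : nat -> nat -> C) (S M : R) (u : nat -> C) (n : nat) :
  schur K S -> (forall m, Cmod (u m) <= M) -> Cmod (kmul K u n) <= S * M.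
Proof.
  intros HK HM. assert (0 <= M) by (eapply Rle_trans; [apply Cmod_ge_0|apply (HM O)]).
  eapply Rle_trans; [apply (kmul_Cmod_sum K S); auto; now exists M|].
  destruct (schur_row K S n HK) as [E L].
  apply Rle_trans with (Series (fun m => M * Cmod (K n m))).
  - apply Series_le; [|now apply ex_series_scalR]. intro m; split.
    + apply Rmult_le_pos; apply Cmod_ge_0.
    + rewrite Rmult_comm. apply Rmult_le_compat_r; auto. apply Cmod_ge_0.
  - rewrite Series_scal_l. rewrite Rmult_comm. apply Rmult_le_compat_r; auto.
Qed.

Lemma kmul_plus (K : nat -> nat -> C) (S : R) (u v : nat -> C) (n : nat) :
  schur K S -> bounded_seq u -> bounded_seq v ->
  kmul K (fun m => (u m + v m)%C) n = (kmul K u n + kmul K v n)%C.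
Proof.
  intros HK Hu Hv. unfold kmul. rewrite <- csum_plus by (now apply kmul_asum with S).
  apply csum_ext; intro; ring.
Qed.

Lemma kmul_scal (K : nat -> nat -> C) (S : R) (c : C) (u : nat -> C) (n : nat) :
  schur K S -> bounded_seq u -> kmul K (fun m => (c * u m)%C) n = (c * kmul K u n)%C.
Proof.
  intros HK Hu. unfold kmul. rewrite <- csum_scal by (now apply kmul_asum with S).
  apply csum_ext; intro m.  ring.
Qed.

Lemma ex_series_finite_support (f : nat -> R) (N : nat) :
  (forall n, (N <= n)%nat -> f n = 0) -> ex_series f.
Proof.
  intro H. apply (ex_series_incr_n f N).
  apply (ex_series_ext (fun k => 0 * 0 ^ k)).
  - intro k. rewrite H by lia. apply Rmult_0_l.
  - apply ex_series_scalR, ex_series_geom. rewrite Rabs_R0. lra.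
Qed.

(** Split [u] where its entries fall below [eps / 2 / S]. The tail contributes at most [eps / 2] by
    the row bound; the head involves finitely many columns, each tending to 0 since it is
    summable. *)
Lemma schur_C0 (K : nat -> nat -> C) (S : R) (u : nat -> C) :
  0 < S -> schur K S -> cconv u 0 -> cconv (kmul K u) 0.
Proof.
  intros HS HK Hu. destruct (cconv_bounded u _ Hu) as [M HM].
  assert (M0 : 0 <= M) by (eapply Rle_trans; [apply Cmod_ge_0|apply (HM O)]).
  apply is_lim_seq_spec. intro eps.
  pose proof (cconv0_Cmod u Hu) as Hl. apply is_lim_seq_spec in Hl.
  assert (e2 : 0 < eps / 2 / S) by (destruct eps; simpl; apply Rdiv_lt_0_compat; lra).
  destruct (Hl (mkposreal _ e2)) as [k Hk]. simpl in Hk.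
  set (head := fun m => if le_lt_dec k m then RtoC 0 else u m).
  set (tail := fun m => if le_lt_dec k m then u m else RtoC 0).
  assert (Hh : forall m, Cmod (head m) <= M).
  { intro m; unfold head; destruct (le_lt_dec k m); auto. now rewrite Cmod_0. }
  assert (Ht : forall m, Cmod (tail m) <= eps / 2 / S).
  { intro m; unfold tail; destruct (le_lt_dec k m) as [L|L].
    - specialize (Hk m L). rewrite Rminus_0_r, Rabs_pos_eq in Hk by apply Cmod_ge_0. lra.
    - rewrite Cmod_0. lra. }
  assert (D : is_lim_seq (fun n => Series (fun m => Cmod (K n m) * Cmod (head m))) 0).
  { apply dominated_Series_lim0 with (fun m => S * Cmod (head m)).
    - apply ex_series_finite_support with k. intros m L. unfold head.
      destruct (le_lt_dec k m); [rewrite Cmod_0; ring|lia].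
    - intros n m. split; [apply Rmult_le_pos; apply Cmod_ge_0|].
      apply Rmult_le_compat_r; [apply Cmod_ge_0|].
      destruct (schur_row K S n HK) as [E L]. eapply Rle_trans; [|apply L].
      apply (term_le_Series (fun m => Cmod (K n m))); auto. intro; apply Cmod_ge_0.
    - intro m. replace (Finite 0) with (Finite (0 * Cmod (head m))) by (f_equal; ring).
      apply is_lim_seq_mult'; [now apply schur_col0 with S|apply is_lim_seq_const]. }
  apply is_lim_seq_spec in D.
  assert (e3 : 0 < eps / 2) by (destruct eps; simpl; lra).
  destruct (D (mkposreal _ e3)) as [n0 Hn0]. exists n0. intros n Hn. specialize (Hn0 n Hn).
  simpl in Hn0. rewrite Rminus_0_r in Hn0. apply Rabs_def2 in Hn0.
  rewrite Rminus_0_r, Rabs_pos_eq by apply Cmod_ge_0.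
  replace (kmul K u n - 0)%C with (kmul K head n + kmul K tail n)%C.
  2:{ rewrite <- (kmul_plus K S); auto; [|now exists M|now exists (eps/2/S)].
      replace (kmul K u n - 0)%C with (kmul K u n) by ring.
      apply csum_ext. intro m. unfold head, tail. destruct (le_lt_dec k m); ring. }
  eapply Rle_lt_trans; [apply Cmod_triangle|].
  pose proof (kmul_Cmod_sum K S head n HK (ex_intro _ M Hh)).
  pose proof (kmul_Cmod_le K S _ tail n HK Ht).
  replace (S * (eps / 2 / S)) with (eps / 2) in H0 by (field; lra). lra.
Qed.

(* Jensen for the sub-probability weights w / S, from the tangent of x^p at the mean. *)
Lemma jensen_rpow (w x : nat -> R) (S p : R) :
  1 <= p -> 0 < S -> (forall n, 0 <= w n) -> (forall n, 0 <= x n) ->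
  ex_series w -> Series w <= S -> ex_series (fun n => w n * x n) ->
  ex_series (fun n => w n * rpow (x n) p) ->
  S * rpow (Series (fun n => w n * x n) / S) p <= Series (fun n => w n * rpow (x n) p).
Proof.
  intros Hp HS Hw Hx Ew Sw Ex Ep. set (s := Series (fun n => w n * x n)).
  assert (P : 0 <= s) by (apply Series_nonneg; auto; intro; now apply Rmult_le_pos).
  destruct P as [P|P].
  2:{ rewrite <- P. unfold Rdiv. rewrite Rmult_0_l, rpow_0, Rmult_0_r. apply Series_nonneg; auto.
      intro; apply Rmult_le_pos; auto; apply rpow_ge0. }
  set (y := s / S). assert (Hy : 0 < y) by now apply Rdiv_lt_0_compat.
  pose proof (rpow_ge0 y p) as Q. set (q := rpow y p) in *.
  apply Rle_trans with (Series (fun n => q * (1 - p) * w n + q * p / y * (w n * x n))).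
  - rewrite Series_plus by (now apply ex_series_scalR).
    rewrite !Series_scal_l. fold s. replace s with (y * S) by (unfold y; field; lra).
    replace (q * p / y * (y * S)) with (q * p * S) by (field; lra).
    (* The constant term of the tangent carries the factor [1 - p <= 0], so a total weight below [S]
       goes in the right direction. *)
    assert (q * (p - 1) * Series w <= q * (p - 1) * S).
    { apply Rmult_le_compat_l; auto. apply Rmult_le_pos; lra. }
    lra.
  - assert (E1 : ex_series (fun n => q * (1 - p) * w n + q * p / y * (w n * x n)))
      by (apply ex_series_plusR; now apply ex_series_scalR).
    assert (0 <= Series (fun n => w n * rpow (x n) p - (q * (1 - p) * w n + q * p / y * (w n * x n)))).
    { apply Series_nonneg.
      - intro n. pose proof (rpow_tangent (x n) y p (Hx n) Hy Hp). fold q in H.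
        pose proof (Rmult_le_compat_l (w n) _ _ (Hw n) H). lra.
      - apply (ex_series_minus (V := R_NormedModule)); auto. }
    rewrite Series_minus in H by auto. lra.
Qed.

(** Since l^p norms are estimated through partial sums, Schur's test needs only this exchange of a
    finite sum with a series, and no theorem on double series. *)
Lemma Series_sum_f (f : nat -> nat -> R) (N : nat) :
  (forall n, ex_series (f n)) ->
  ex_series (fun m => sum_f_R0 (fun n => f n m) N) /\
  sum_f_R0 (fun n => Series (f n)) N = Series (fun m => sum_f_R0 (fun n => f n m) N).
Proof.
  intro H. induction N as [|N [E IH]]; simpl; [split; [apply H|reflexivity]|].
  split; [now apply ex_series_plusR|]. rewrite IH. symmetry. now apply Series_plus.
Qed.

(** Jensen on row [n] bounds [Cmod (kmul K u n)^p] by [S^(p-1)] times the average of [Cmod (u m)^p]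
    against that row; summing over [n], the column bound supplies the last factor [S]. The quotient
    [rpow S p / S] stands for [S^(p-1)]. *)
Lemma schur_Lp (K : nat -> nat -> C) (S p : R) (u : nat -> C) :
  1 <= p -> 0 < S -> schur K S -> inX (Lp p) u ->
  inX (Lp p) (kmul K u) /\ normX (Lp p) (kmul K u) <= S * normX (Lp p) u.
Proof.
  intros Hp HS HK Hu. pose proof (inX_bounded (Lp p) u Hp Hu) as HB.
  set (U := fun m => rpow (Cmod (u m)) p).
  assert (U0 : forall m, 0 <= U m) by (intro; apply rpow_ge0).
  assert (KS : forall n m, Cmod (K n m) <= S).
  { intros n m. destruct (schur_row K S n HK) as [E L]. eapply Rle_trans; [|apply L].
    apply (term_le_Series (fun m => Cmod (K n m))); auto. intro; apply Cmod_ge_0. }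
  assert (EU : forall n, ex_series (fun m => Cmod (K n m) * U m)).
  { intro n. apply ex_series_dom with (fun m => S * U m); [|now apply ex_series_scalR].
    intro m. split; [apply Rmult_le_pos; auto; apply Cmod_ge_0|]. apply Rmult_le_compat_r; auto. }
  assert (T : forall n, rpow (Cmod (kmul K u n)) p <= rpow S p / S * Series (fun m => Cmod (K n m) * U m)).
  { intro n. destruct (schur_row K S n HK) as [E L].
    assert (Eu : ex_series (fun m => Cmod (K n m) * Cmod (u m))).
    { pose proof (kmul_asum K S u n HK HB) as A.
      apply (ex_series_ext _ _ (fun m => Cmod_mult (K n m) (u m))). exact A. }
    pose proof (jensen_rpow (fun m => Cmod (K n m)) (fun m => Cmod (u m)) S p Hp HS
      (fun _ => Cmod_ge_0 _) (fun _ => Cmod_ge_0 _) E L Eu (EU n)) as J.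
    set (s := Series (fun m => Cmod (K n m) * Cmod (u m))) in *.
    assert (0 <= s) by (apply Series_nonneg; auto; intro; apply Rmult_le_pos; apply Cmod_ge_0).
    apply Rle_trans with (rpow S p * rpow (s / S) p).
    - rewrite <- rpow_mult by (try apply Rdiv_le_0_compat; lra).
      apply rpow_le; [lra|]. replace (S * (s / S)) with s by (field; lra).
      now apply kmul_Cmod_sum with S.
    - replace (rpow S p * rpow (s / S) p) with (rpow S p / S * (S * rpow (s / S) p)) by (field; lra).
      apply Rmult_le_compat_l; auto. apply Rdiv_le_0_compat; auto. apply rpow_ge0. }
  apply Lp_norm_scal_le; auto; [lra| |].
  - now apply Series_nonneg.
  - intro N.
    apply Rle_trans with (sum_f_R0 (fun n => Series (fun m => Cmod (K n m) * U m) * (rpow S p / S)) N).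
    { apply sum_Rle. intros n _. rewrite Rmult_comm. apply T. }
    rewrite <- scal_sum.
    destruct (Series_sum_f (fun n m => Cmod (K n m) * U m) N EU) as [E1 ->].
    replace (rpow S p) with (rpow S p / S * S) at 2 by (field; lra). rewrite Rmult_assoc.
    apply Rmult_le_compat_l; [apply Rdiv_le_0_compat; auto; apply rpow_ge0|].
    fold U. rewrite <- Series_scal_l. apply Series_le; [|now apply ex_series_scalR].
    intro m. split.
    + apply cond_pos_sum. intro; apply Rmult_le_pos; auto; apply Cmod_ge_0.
    + rewrite <- (scal_sum (fun n => Cmod (K n m))), Rmult_comm.
      apply Rmult_le_compat_r; auto. apply HK.
Qed.

Lemma schur_bounded (K : nat -> nat -> C) (S : R) (X : space) (u : nat -> C) :
  valid_space X -> solid X -> 0 < S -> schur K S -> inX X u ->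
  inX X (kmul K u) /\ normX X (kmul K u) <= S * normX X u.
Proof.
  intros V Sol HS HK Hu.
  assert (B : forall n, Cmod (kmul K u n) <= S * normX X u).
  { intro n. apply kmul_Cmod_le; auto. intro; now apply Cmod_le_normX. }
  destruct X as [p| | |]; simpl in Sol; try contradiction.
  - now apply schur_Lp.
  - split; [exact (ex_intro _ _ B)|exact (supnorm_le _ _ B)].
  - split; [now apply schur_C0 with S|exact (supnorm_le _ _ B)].
Qed.

(** * Partial fractions and the products [pi_partial] *)

Fixpoint rprod (g : nat -> R) (N : nat) : R :=
  match N with O => 1 | S N' => rprod g N' * g N' end.

Lemma rprod_ext (f g : nat -> R) (N : nat) :
  (forall j, (j < N)%nat -> f j = g j) -> rprod f N = rprod g N.
Proof.
  induction N as [|N IH]; intro H; simpl; auto. rewrite IH, H; auto.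
Qed.

Lemma rprod_zero (g : nat -> R) (N m : nat) : (m < N)%nat -> g m = 0 -> rprod g N = 0.
Proof.
  intros Hm H. induction N as [|N IH]; [lia|simpl].
  destruct (Nat.eq_dec m N) as [->|D]; [rewrite H; ring|rewrite IH by lia; ring].
Qed.

Lemma rprod_inv (g : nat -> R) (N : nat) : rprod (fun j => / g j) N = / rprod g N.
Proof.
  induction N as [|N IH]; simpl; [now rewrite Rinv_1|]. now rewrite IH, Rinv_mult.
Qed.

Lemma rprod_scal_one (c : R) (g : nat -> R) (N m : nat) :
  (m < N)%nat -> rprod (fun j => if Nat.eq_dec j m then c * g j else g j) N = c * rprod g N.
Proof.
  intro Hm. induction N as [|N IH]; [lia|simpl].
  destruct (Nat.eq_dec N m) as [->|D].
  - rewrite (rprod_ext _ g); [ring|]. intros j Hj. destruct (Nat.eq_dec j m); [lia|auto].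
  - rewrite IH by lia. ring.
Qed.

(** For [n < N], the residue at [a n] of the rational function with zeros [w j] and simple poles
    [a j], [j < N]. *)
Definition residue (a w : nat -> R) (N n : nat) : R :=
  (a n - w n) * rprod (fun j => if Nat.eq_dec j n then 1 else (a n - w j) / (a n - a j)) N.

(** The term 1 is the value at infinity. The point [z] is quantified inside the induction because
    the residue at the new pole is computed from the induction hypothesis at [z = a (S N)]. *)
Lemma partial_fractions (a w : nat -> R) (N : nat) :
  (forall i j, i <> j -> a i <> a j) ->
  forall z, (forall j, (j <= N)%nat -> z <> a j) ->
  rprod (fun j => (z - w j) / (z - a j)) (S N) =
  1 + sum_f_R0 (fun n => residue a w (S N) n / (z - a n)) N.
Proof.
  intro Ha. induction N as [|N IH]; intros z Hz.
  - simpl. unfold residue; simpl. specialize (Hz O (le_n _)). field. lra.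
  - assert (Hz' : z - a (S N) <> 0) by (specialize (Hz (S N) (le_n _)); lra).
    change (rprod (fun j => (z - w j) / (z - a j)) (S (S N)))
      with (rprod (fun j => (z - w j) / (z - a j)) (S N) * ((z - w (S N)) / (z - a (S N)))).
    rewrite IH by (intros; apply Hz; lia).
    rewrite tech5.
    assert (RN : residue a w (S (S N)) (S N) =
       (a (S N) - w (S N)) * (1 + sum_f_R0 (fun n => residue a w (S N) n / (a (S N) - a n)) N)).
    { rewrite <- IH by (intros; apply Ha; lia). unfold residue. f_equal.
      change (rprod ?f (S (S N))) with (rprod f (S N) * f (S N)). cbv beta.
      destruct (Nat.eq_dec (S N) (S N)); [|easy]. rewrite Rmult_1_r.
      apply rprod_ext. intros j Hj. destruct (Nat.eq_dec j (S N)); [lia|auto]. }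
    rewrite RN.
    set (c := (a (S N) - w (S N)) / (z - a (S N))).
    (* Each old residue gains the factor [(a n - w (S N)) / (a n - a (S N))]. Splitting it over the
       poles [a n] and [a (S N)] leaves the old sum times the new factor, minus exactly the sum that
       occurs in [RN]. *)
    assert (E : sum_f_R0 (fun n => residue a w (S (S N)) n / (z - a n)) N =
      sum_f_R0 (fun n => residue a w (S N) n / (z - a n) * ((z - w (S N)) / (z - a (S N)))
                         - residue a w (S N) n / (a (S N) - a n) * c) N).
    { apply sum_eq. intros n Hn.
      assert (R : residue a w (S (S N)) n = residue a w (S N) n * ((a n - w (S N)) / (a n - a (S N)))).
      { unfold residue. change (rprod ?f (S (S N))) with (rprod f (S N) * f (S N)). cbv beta.
        destruct (Nat.eq_dec (S N) n); [lia|ring]. }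
      rewrite R. unfold c. assert (a n <> a (S N)) by (apply Ha; lia).
      assert (z <> a n) by (apply Hz; lia). field. repeat split; lra. }
    rewrite E, minus_sum, <- !scal_sum. unfold c. field. exact Hz'.
Qed.

Lemma pi_partial_rprod (a : nat -> R) (n N : nat) :
  pi_partial a n N = 2 * rprod (fun m => if Nat.eq_dec m n then 1 else pi_factor a n m) N.
Proof. induction N as [|N IH]; simpl; [ring|]. rewrite IH. ring. Qed.

Lemma decr_lt (a : nat -> R) : (forall n, a (S n) < a n) -> forall i j, (i < j)%nat -> a j < a i.
Proof.
  intros H i j L. induction L; [apply H|]. specialize (H m). lra.
Qed.

Lemma decr_neq (a : nat -> R) :
  (forall n, a (S n) < a n) -> forall i j, i <> j -> a i <> a j.
Proof.
  intros H i j D. destruct (lt_dec i j) as [L|L].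
  - pose proof (decr_lt a H i j L). lra.
  - assert (L' : (j < i)%nat) by lia. pose proof (decr_lt a H j i L'). lra.
Qed.

Lemma pi_factor_eq (a : nat -> R) (n m : nat) :
  0 < a n -> a n <> a m -> pi_factor a n m = (a n + a m) / (a n - a m).
Proof. intros H D. unfold pi_factor. field. lra. Qed.

Lemma pi_factor_neq0 (a : nat -> R) (n m : nat) :
  0 < a n -> 0 < a m -> a n <> a m -> pi_factor a n m <> 0.
Proof.
  intros H H' D. rewrite pi_factor_eq by auto.
  apply Rmult_integral_contrapositive_currified; [lra|apply Rinv_neq_0_compat; lra].
Qed.

(** With the zeros at [- a j], the leading factor is [2 * a n]: this is the origin of the initial
    value 2 in [pi_partial]. *)
Lemma residue_neg (a : nat -> R) (N n : nat) :
  (forall i j, i <> j -> a i <> a j) -> (forall n, 0 < a n) ->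
  residue a (fun j => - a j) N n = a n * pi_partial a n N.
Proof.
  intros D P. unfold residue. rewrite pi_partial_rprod.
  rewrite (rprod_ext _ (fun m => if Nat.eq_dec m n then 1 else pi_factor a n m)); [ring|].
  intros j _. destruct (Nat.eq_dec j n) as [|E]; auto.
  rewrite pi_factor_eq; auto. f_equal. ring.
Qed.

(** Partial fractions at [z = - a m]. As [m <= N], this point is a zero of the product, so the left
    side vanishes. *)
Lemma pi_partial_sum (a : nat -> R) (N m : nat) :
  (forall i j, i <> j -> a i <> a j) -> (forall n, 0 < a n) -> (m <= N)%nat ->
  sum_f_R0 (fun n => a n * pi_partial a n (S N) / (a n + a m)) N = 1.
Proof.
  intros D P Hm.
  pose proof (partial_fractions a (fun j => - a j) N D (- a m)) as H.
  rewrite (rprod_zero _ _ m) in H; [|lia|unfold Rdiv; ring].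
  assert (E : sum_f_R0 (fun n => a n * pi_partial a n (S N) / (a n + a m)) N =
     - sum_f_R0 (fun n => residue a (fun j => - a j) (S N) n / (- a m - a n)) N).
  { replace (- sum_f_R0 (fun n => residue a (fun j => - a j) (S N) n / (- a m - a n)) N)
      with ((-1) * sum_f_R0 (fun n => residue a (fun j => - a j) (S N) n / (- a m - a n)) N) by ring.
    rewrite scal_sum. apply sum_eq. intros n _. rewrite residue_neg by auto.
    pose proof (P n); pose proof (P m). field. lra. }
  rewrite E, <- (Rplus_0_l (- _)). rewrite H at 1; [ring|].
  intros j _. pose proof (P j); pose proof (P m). lra.
Qed.

(* Partial fractions at z = -a_m after moving the zero -a_m of the numerator to 0. *)
Lemma pi_partial_sum_sqr (a : nat -> R) (N m : nat) :
  (forall i j, i <> j -> a i <> a j) -> (forall n, 0 < a n) -> (m <= N)%nat ->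
  a m * pi_partial a m (S N) *
  sum_f_R0 (fun n => a n * pi_partial a n (S N) / ((a n + a m) * (a n + a m))) N = 1.
Proof.
  intros D P Hm.
  set (w := fun j => if Nat.eq_dec j m then 0 else - a j).
  (* Moving the zero from [- a m] to 0 replaces the factor [a n + a m] of the residue by [a n]. *)
  assert (W : forall n, residue a w (S N) n = a n * pi_partial a n (S N) * (a n / (a n + a m))).
  { intro n. rewrite <- residue_neg by auto. unfold residue.
    pose proof (P n); pose proof (P m).
    destruct (Nat.eq_dec n m) as [->|E].
    - rewrite (rprod_ext _ (fun j => if Nat.eq_dec j m then 1 else (a m - - a j) / (a m - a j))).
      + unfold w. destruct (Nat.eq_dec m m); [|easy]. field. lra.
      + intros j _. unfold w. destruct (Nat.eq_dec j m); auto.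
    - rewrite (rprod_ext _ (fun j => if Nat.eq_dec j m
         then a n / (a n + a m) * (if Nat.eq_dec j n then 1 else (a n - - a j) / (a n - a j))
         else (if Nat.eq_dec j n then 1 else (a n - - a j) / (a n - a j)))).
      + rewrite rprod_scal_one by lia. unfold w at 1. destruct (Nat.eq_dec n m); [easy|]. ring.
      + intros j _. unfold w. destruct (Nat.eq_dec j n), (Nat.eq_dec j m); subst; auto; try easy.
        pose proof (D n m E). field. lra. }
  (* At [z = - a m] the factor [j = m] equals 1/2 and every other factor is the inverse of
     [pi_factor a m j]. *)
  assert (L : rprod (fun j => (- a m - w j) / (- a m - a j)) (S N) = / pi_partial a m (S N)).
  { rewrite pi_partial_rprod, Rinv_mult, <- rprod_inv, <- (rprod_scal_one (/ 2) _ (S N) m) by lia.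
    apply rprod_ext. intros j _. unfold w. pose proof (P m); pose proof (P j).
    destruct (Nat.eq_dec j m) as [->|E].
    - field. lra.
    - assert (a m <> a j) by auto. rewrite pi_factor_eq by auto. field. lra. }
  pose proof (partial_fractions a w N D (- a m)) as H. rewrite L in H.
  pose proof (pi_partial_sum a N m D P Hm) as S1.
  set (s := sum_f_R0 (fun n => a n * pi_partial a n (S N) / ((a n + a m) * (a n + a m))) N).
  (* Write the extra factor [a n] as [(a n + a m) - a m]: the first part sums to 1 by
     [pi_partial_sum], the second gives [a m * s]. *)
  assert (E : sum_f_R0 (fun n => residue a w (S N) n / (- a m - a n)) N = a m * s - 1).
  { rewrite <- S1. unfold s. rewrite scal_sum, <- minus_sum. apply sum_eq. intros n _.
    rewrite W. pose proof (P n); pose proof (P m). field. lra. }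
  rewrite E in H.
  assert (Q : pi_partial a m (S N) <> 0).
  { clear - D P. induction (S N) as [|k IH]; simpl; [lra|].
    apply Rmult_integral_contrapositive_currified; auto.
    destruct (Nat.eq_dec k m); [lra|]. apply pi_factor_neq0; auto. }
  assert (H' : / pi_partial a m (S N) = a m * s).
  { rewrite H; [ring|]. intros j _. pose proof (P j); pose proof (P m). lra. }
  rewrite Rmult_assoc, (Rmult_comm (pi_partial _ _ _)), <- Rmult_assoc, <- H'. now field.
Qed.

(** Times [a p - a m], the kernel is the difference of [1 / (a n + a m)] and [1 / (a n + a p)]; the
    two resulting sums are both 1. *)
Lemma pi_partial_sum_cross (a : nat -> R) (N m p : nat) :
  (forall i j, i <> j -> a i <> a j) -> (forall n, 0 < a n) ->
  (m <= N)%nat -> (p <= N)%nat -> m <> p ->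
  sum_f_R0 (fun n => a n * pi_partial a n (S N) / ((a n + a m) * (a n + a p))) N = 0.
Proof.
  intros D P Hm Hp E. pose proof (D m p E).
  apply Rmult_eq_reg_l with (a p - a m); [|lra]. rewrite Rmult_0_r, scal_sum.
  rewrite <- (Rminus_diag 1). rewrite <- (pi_partial_sum a N m) at 1 by auto.
  rewrite <- (pi_partial_sum a N p) by auto. rewrite <- minus_sum. apply sum_eq. intros n _.
  pose proof (P n); pose proof (P m); pose proof (P p). field. lra.
Qed.

Lemma Series_trunc (f : nat -> R) (N : nat) :
  Series (fun n => if le_dec n N then f n else 0) = sum_f_R0 f N.
Proof.
  rewrite (Series_incr_n _ (S N)); [|lia|].
  - rewrite (Series_ext _ (fun n => 0 * 0)).
    + rewrite Series_scal_l. simpl Init.Nat.pred. rewrite Rmult_0_l, Rplus_0_r.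
      apply sum_eq. intros i Hi. destruct (le_dec i N); [auto|lia].
    + intro n. destruct (le_dec (S N + n) N); [lia|ring].
  - apply ex_series_finite_support with (S N). intros n Hn. destruct (le_dec n N); [lia|auto].
Qed.

(** Sums whose length grows with [N] become series after extension by 0; for a fixed index this
    changes only finitely many [N]. *)
Lemma tannery_sum (f : nat -> nat -> R) (l g : nat -> R) :
  ex_series g -> (forall N n, (n <= N)%nat -> Rabs (f N n) <= g n) ->
  (forall n, is_lim_seq (fun N => f N n) (l n)) ->
  is_lim_seq (fun N => sum_f_R0 (f N) N) (Series l).
Proof.
  intros Eg Hf Hl.
  apply is_lim_seq_ext with (fun N => Series (fun n => if le_dec n N then f N n else 0)).
  { intro N. apply Series_trunc. }
  apply (tannery (fun N n => if le_dec n N then f N n else 0) l g); auto.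
  - intros N n. destruct (le_dec n N); auto. rewrite Rabs_R0.
    eapply Rle_trans; [apply Rabs_pos|apply (Hf n n (le_n _))].
  - intro n. apply is_lim_seq_ext_loc with (fun N => f N n); auto.
    exists n. intros N L. destruct (le_dec n N); [auto|lia].
Qed.

Lemma is_lim_pi (a : nat -> R) (n : nat) :
  pi_in_linf a -> is_lim_seq (fun N => pi_partial a n (S N)) (pi_seq a n).
Proof.
  intros [H _]. specialize (H n). apply (is_lim_seq_incr_1 (pi_partial a n)).
  now apply Lim_seq_correct'.
Qed.

(* For m > n the factors of pi_n have modulus at least 1. *)
Lemma pi_partial_le (a : nat -> R) (n N : nat) :
  (forall n, a (S n) < a n) -> (forall n, 0 < a n) -> pi_in_linf a -> (n <= N)%nat ->
  Rabs (pi_partial a n (S N)) <= Rabs (pi_seq a n).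
Proof.
  intros Ha P Hpi L.
  pose proof (is_lim_seq_abs _ _ (is_lim_pi a n Hpi)) as A. simpl Rbar_abs in A.
  apply (is_lim_seq_incr_n (fun N => Rabs (pi_partial a n (S N))) n) in A.
  replace N with ((N - n) + n)%nat by lia.
  apply (is_lim_seq_incr_compare (fun k => Rabs (pi_partial a n (S (k + n)))) _ A).
  intro k. replace (S (S k + n)) with (S (S (k + n))) by lia.
  change (pi_partial a n (S (S (k + n)))) with (pi_partial a n (S (k + n)) *
     (if Nat.eq_dec (S (k + n)) n then 1 else pi_factor a n (S (k + n)))).
  destruct (Nat.eq_dec (S (k + n)) n); [lia|].
  rewrite Rabs_mult. rewrite <- (Rmult_1_r (Rabs (pi_partial a n (S (k + n))))) at 1.
  apply Rmult_le_compat_l; [apply Rabs_pos|].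
  assert (B : a (S (k + n)) < a n) by (apply decr_lt; auto; lia).
  pose proof (P n); pose proof (P (S (k + n))).
  rewrite pi_factor_eq by lra.
  eapply Rle_trans; [|apply Rle_abs].
  apply Rmult_le_reg_r with (a n - a (S (k + n))); [lra|].
  unfold Rdiv. rewrite Rmult_assoc, Rinv_l by lra. lra.
Qed.

(** The majorant is [M * B * a n]: within the range [n <= N] the partial products are bounded by
    their limit, hence by [M], uniformly in [N]. *)
Lemma pi_sum_lim (a c : nat -> R) (M B : R) :
  (forall n, a (S n) < a n) -> (forall n, 0 < a n) -> pi_in_linf a ->
  (forall n, Rabs (pi_seq a n) <= M) -> ex_series a -> (forall n, Rabs (c n) <= B) ->
  is_lim_seq (fun N => sum_f_R0 (fun n => a n * pi_partial a n (S N) * c n) N)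
    (Series (fun n => a n * pi_seq a n * c n)).
Proof.
  intros Ha P Hpi HM Ea Hc.
  apply (tannery_sum (fun N n => a n * pi_partial a n (S N) * c n) _ (fun n => M * B * a n)).
  - now apply ex_series_scalR.
  - intros N n L. rewrite !Rabs_mult, (Rabs_pos_eq (a n)) by (left; apply P).
    pose proof (pi_partial_le a n N Ha P Hpi L) as Q. specialize (HM n). specialize (Hc n).
    pose proof (Rabs_pos (c n)). pose proof (Rabs_pos (pi_partial a n (S N))).
    specialize (P n). rewrite (Rmult_comm (M * B)), Rmult_assoc.
    apply Rmult_le_compat_l; [lra|]. apply Rmult_le_compat; lra.
  - intro n. apply is_lim_seq_mult'; [|apply is_lim_seq_const].
    apply is_lim_seq_mult'; [apply is_lim_seq_const|now apply is_lim_pi].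
Qed.

Lemma inv_sum_le (x y : R) : 0 < x -> 0 < y -> 0 < / (x + y) <= / y.
Proof.
  intros. split; [apply Rinv_0_lt_compat; lra|]. apply Rinv_le_contravar; lra.
Qed.

Lemma pi_sum (a : nat -> R) (m : nat) :
  (forall n, a (S n) < a n) -> (forall n, 0 < a n) -> pi_in_linf a -> ex_series a ->
  Series (fun n => a n * pi_seq a n / (a n + a m)) = 1.
Proof.
  intros Ha P Hpi Ea. destruct (proj2 Hpi) as [M HM].
  assert (H : is_lim_seq (fun N => sum_f_R0 (fun n => a n * pi_partial a n (S N) * / (a n + a m)) N)
    (Series (fun n => a n * pi_seq a n * / (a n + a m)))).
  { apply (pi_sum_lim a (fun n => / (a n + a m)) M (/ a m)); auto.
    intro n. destruct (inv_sum_le (a n) (a m)); auto. rewrite Rabs_pos_eq; lra. }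
  apply is_lim_seq_unique in H.
  rewrite (Lim_seq_ext_loc _ (fun _ => 1)), Lim_seq_const in H.
  - injection H as H. now symmetry.
  - exists m. intros N L. apply pi_partial_sum; auto. now apply decr_neq.
Qed.

(** Up to the factor [b m / b p], this is the entry [(m, p)] of the square of [J]. The finite
    identities hold once [N] exceeds both indices. *)
Lemma pi_sum_involution (a : nat -> R) (m p : nat) :
  (forall n, a (S n) < a n) -> (forall n, 0 < a n) -> pi_in_linf a -> ex_series a ->
  a p * pi_seq a p * Series (fun n => a n * pi_seq a n / ((a n + a m) * (a n + a p)))
  = if Nat.eq_dec m p then 1 else 0.
Proof.
  intros Ha P Hpi Ea. destruct (proj2 Hpi) as [M HM].
  assert (H : is_lim_seq (fun N => sum_f_R0 (fun n => a n * pi_partial a n (S N) * / ((a n + a m) * (a n + a p))) N)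
    (Series (fun n => a n * pi_seq a n * / ((a n + a m) * (a n + a p))))).
  { apply (pi_sum_lim a (fun n => / ((a n + a m) * (a n + a p))) M (/ a m * / a p)); auto.
    intro n. destruct (inv_sum_le (a n) (a m)); auto. destruct (inv_sum_le (a n) (a p)); auto.
    rewrite Rinv_mult, Rabs_pos_eq; [|apply Rmult_le_pos; lra].
    apply Rmult_le_compat; lra. }
  assert (H2 : is_lim_seq (fun N => a p * pi_partial a p (S N) * sum_f_R0 (fun n => a n * pi_partial a n (S N) * / ((a n + a m) * (a n + a p))) N)
    (a p * pi_seq a p * Series (fun n => a n * pi_seq a n * / ((a n + a m) * (a n + a p))))).
  { apply is_lim_seq_mult'; auto. apply is_lim_seq_mult'; [apply is_lim_seq_const|now apply is_lim_pi]. }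
  apply is_lim_seq_unique in H2.
  rewrite (Lim_seq_ext_loc _ (fun _ => if Nat.eq_dec m p then 1 else 0)), Lim_seq_const in H2.
  - injection H2 as H2. now symmetry.
  - exists (m + p)%nat. intros N L.
    assert (D := decr_neq a Ha).
    destruct (Nat.eq_dec m p) as [->|E].
    + apply pi_partial_sum_sqr; auto; lia.
    + rewrite <- (Rmult_0_r (a p * pi_partial a p (S N))). f_equal.
      apply pi_partial_sum_cross; auto; lia.
Qed.

(** * The involution [J] *)

Definition Jker (a : nat -> R) (b : nat -> C) (n m : nat) : C :=
  (b n / b m * RtoC (a m * pi_seq a m / (a n + a m)))%C.

(** The interface between the hypotheses and the dynamics. Spatial decay enters through [set_sum],
    [set_k] and [set_J]; nothing here mentions [X], so one constant [S] serves every space. *)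
Record setting (a : nat -> R) (b : nat -> C) (S : R) : Prop := {
  set_decr : forall n, a (Datatypes.S n) < a n;
  set_pos : forall n, 0 < a n;
  set_lim : is_lim_seq a 0;
  set_pi : pi_in_linf a;
  set_sum : ex_series a;
  set_b0 : forall n, b n <> RtoC 0;
  set_bb : bounded_seq b;
  set_k : in_l1 (k_ma a b);
  set_S : 0 < S;
  set_J : schur (Jker a b) S }.

Lemma natdist_sym (i j : nat) : natdist i j = natdist j i.
Proof. unfold natdist; lia. Qed.

Lemma sum_pow_natdist (mu : R) (n N : nat) :
  0 < mu < 1 -> sum_f_R0 (fun m => mu ^ natdist n m) N <= 2 / (1 - mu).
Proof.
  intro Hmu.
  (* A bound sharpened for induction on [n]: passing to [S n] splits off the term [m = 0], equal to
     [mu ^ S n], and the right side grows by exactly that amount. *)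
  assert (H : sum_f_R0 (fun m => mu ^ natdist n m) N <= (2 - mu ^ S n) / (1 - mu)).
  { revert N. induction n as [|n IH]; intro N.
    - rewrite (sum_eq _ (fun m => mu ^ m)).
      2:{ intros i _. f_equal. unfold natdist; lia. }
      rewrite tech3 by lra. apply Rmult_le_compat_r; [left; apply Rinv_0_lt_compat; lra|].
      pose proof (pow_lt mu (S N)). lra.
    - destruct N as [|N].
      + assert (mu ^ S n <= 1) by (rewrite <- (pow1 (S n)); apply pow_incr; lra).
        assert (0 < mu ^ S n) by (apply pow_lt; lra).
        change (mu ^ natdist (S n) 0 <= (2 - mu * mu ^ S n) / (1 - mu)).
        replace (natdist (S n) 0) with (S n) by (unfold natdist; lia).
        apply Rmult_le_reg_r with (1 - mu); [lra|]. unfold Rdiv.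
        rewrite (Rmult_assoc _ (/ _)), Rinv_l by lra. nra.
      + rewrite decomp_sum by lia. simpl Init.Nat.pred.
        rewrite (sum_eq _ (fun m => mu ^ natdist n m)) by (intros i _; f_equal).
        specialize (IH N).
        replace (natdist (S n) 0) with (S n) by (unfold natdist; lia).
        replace ((2 - mu ^ S (S n)) / (1 - mu)) with (mu ^ S n + (2 - mu ^ S n) / (1 - mu))
          by (simpl; field; lra). lra. }
  eapply Rle_trans; [exact H|].
  apply Rmult_le_compat_r; [left; apply Rinv_0_lt_compat; lra|].
  assert (0 < mu ^ S n) by (apply pow_lt; lra). lra.
Qed.

Lemma phi_eq (a : nat -> R) (b : nat -> C) (i j : nat) :
  (forall n, 0 < a n) -> phi a b i j = Cmod (b i / b j)%C * a j / (a i + a j).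
Proof. intro P. pose proof (P i); pose proof (P j). unfold phi. field. lra. Qed.

Lemma Jker_phi (a : nat -> R) (b : nat -> C) (n m : nat) :
  (forall n, 0 < a n) -> Cmod (Jker a b n m) = phi a b n m * Rabs (pi_seq a m).
Proof.
  intro P. pose proof (P n); pose proof (P m). rewrite phi_eq by auto.
  unfold Jker. rewrite Cmod_mult, Cmod_R. unfold Rdiv.
  rewrite !Rabs_mult, (Rabs_pos_eq (a m)), (Rabs_pos_eq (/ (a n + a m))); [ring| |lra].
  left; apply Rinv_0_lt_compat; lra.
Qed.

(** The quotients of [b] in the two entries are inverse to each other. Geometric decay of [phi 0 j]
    therefore forces geometric decay of [a j], whatever [b] is. *)
Lemma phi_diag_product (a : nat -> R) (b : nat -> C) (j : nat) :
  (forall n, 0 < a n) -> (forall n, b n <> RtoC 0) ->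
  a j * a 0%nat = phi a b 0 j * phi a b j 0 * (a 0%nat + a j) ^ 2.
Proof.
  intros P B. rewrite !phi_eq by auto. rewrite !Cmod_div by auto.
  pose proof (P 0%nat); pose proof (P j).
  assert (Cmod (b 0%nat) <> 0) by (apply Rgt_not_eq, Cmod_gt_0, B).
  assert (Cmod (b j) <> 0) by (apply Rgt_not_eq, Cmod_gt_0, B).
  field. lra.
Qed.

Lemma setting_intro (X : space) (a : nat -> R) (b : nat -> C) :
  valid_space X -> standing X a b -> pi_in_linf a -> spatially_exp_decays a b ->
  exists S, setting a b S.
Proof.
  intros V (Ha & P & L & Hb & B0) Hpi (K & mu & HK & Hmu & Hphi).
  destruct (proj2 Hpi) as [M HM].
  assert (M0 : 0 <= M) by (eapply Rle_trans; [apply Rabs_pos|apply (HM O)]).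
  assert (A0 : forall j, a j <= a 0%nat).
  { intros [|j]; [lra|]. left. apply decr_lt; auto; lia. }
  assert (Hphi0 : forall j, phi a b 0 j <= K * mu ^ j).
  { intro j. replace j with (natdist 0 j) at 2 by (unfold natdist; lia). apply Hphi. }
  assert (Pphi : forall i j, 0 <= phi a b i j).
  { intros i j. rewrite phi_eq by auto. pose proof (P i); pose proof (P j).
    apply Rdiv_le_0_compat; [|lra]. apply Rmult_le_pos; [apply Cmod_ge_0|lra]. }
  assert (G : ex_series (fun j => mu ^ j)) by (apply ex_series_geom; rewrite Rabs_pos_eq; lra).
  (* [M + 1] replaces [M] to keep [c], and with it the Schur constant, positive. *)
  set (c := K * (M + 1)).
  assert (Hc : 0 < c) by (apply Rmult_lt_0_compat; lra).
  assert (HJ : forall n m, Cmod (Jker a b n m) <= mu ^ natdist n m * c).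
  { intros n m. rewrite Jker_phi by auto. unfold c.
    apply Rle_trans with (K * mu ^ natdist n m * (M + 1)); [|lra].
    apply Rmult_le_compat; auto; [apply Rabs_pos|]. specialize (HM m). lra. }
  exists (c * (2 / (1 - mu))). constructor; auto.
  (* In [phi_diag_product], [phi 0 j] gives [K * mu ^ j], [phi j 0] gives [K], and
     [(a 0 + a j)^2 <= 4 (a 0)^2]; dividing by [a 0] leaves this constant. *)
  - apply ex_series_dom with (fun j => (4 * a 0%nat * K ^ 2) * mu ^ j); [|now apply ex_series_scalR].
    intro j. split; [left; apply P|].
    pose proof (phi_diag_product a b j P B0) as E. pose proof (P 0%nat) as P0. pose proof (P j) as Pj.
    apply Rmult_le_reg_r with (a 0%nat); auto. rewrite E.
    replace (4 * a 0%nat * K ^ 2 * mu ^ j * a 0%nat) with ((K * mu ^ j * K) * (2 * a 0%nat) ^ 2) by ring.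
    assert (T : phi a b j 0 <= K).
    { eapply Rle_trans; [apply Hphi|]. rewrite <- (Rmult_1_r K) at 2.
      apply Rmult_le_compat_l; [lra|]. rewrite <- (pow1 (natdist j 0)). apply pow_incr; lra. }
    apply Rmult_le_compat; [now apply Rmult_le_pos|apply pow2_ge_0| |].
    + apply Rmult_le_compat; auto.
    + apply pow_incr. specialize (A0 j). lra.
  - now apply inX_bounded with X.
  (* The division by the possibly tiny [b j] is absorbed by row 0 of [Phi]: [a j / Cmod (b j)]
     equals [phi 0 j * (a 0 + a j) / Cmod (b 0)]. *)
  - apply ex_series_dom with (fun j => (2 * a 0%nat * K * M / Cmod (b 0%nat)) * mu ^ j);
      [|now apply ex_series_scalR].
    intro j. split; [apply Cmod_ge_0|]. unfold k_ma.
    rewrite Cmod_div, Cmod_R, Rabs_mult, Rabs_Ropp, (Rabs_pos_eq (a j)) by (auto; left; apply P).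
    assert (0 < Cmod (b 0%nat)) by (apply Cmod_gt_0, B0).
    assert (0 < Cmod (b j)) by (apply Cmod_gt_0, B0).
    pose proof (P 0%nat) as P0. pose proof (P j) as Pj.
    replace (a j * Rabs (pi_seq a j) / Cmod (b j))
      with (phi a b 0 j * (Rabs (pi_seq a j) * ((a 0%nat + a j) / Cmod (b 0%nat)))).
    2:{ rewrite phi_eq, Cmod_div by auto. field. lra. }
    apply Rle_trans with ((K * mu ^ j) * (M * (2 * a 0%nat / Cmod (b 0%nat)))).
    + assert (0 < / Cmod (b 0%nat)) by now apply Rinv_0_lt_compat.
      apply Rmult_le_compat; auto.
      * apply Rmult_le_pos; [apply Rabs_pos|]. apply Rmult_le_pos; lra.
      * apply Rmult_le_compat; auto; [apply Rabs_pos| |].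
        -- apply Rmult_le_pos; lra.
        -- apply Rmult_le_compat_r; [lra|]. specialize (A0 j). lra.
    + right. field. lra.
  - apply Rmult_lt_0_compat; auto. apply Rdiv_lt_0_compat; lra.
  - split; intros i N.
    + eapply Rle_trans; [apply sum_Rle; intros m _; apply HJ|].
      rewrite <- (scal_sum (fun m => mu ^ natdist i m)).
      apply Rmult_le_compat_l; [lra|]. now apply sum_pow_natdist.
    + eapply Rle_trans; [apply sum_Rle; intros m _; apply HJ|].
      rewrite (sum_eq _ (fun m => mu ^ natdist i m * c)) by (intros m _; now rewrite natdist_sym).
      rewrite <- (scal_sum (fun m => mu ^ natdist i m)).
      apply Rmult_le_compat_l; [lra|]. now apply sum_pow_natdist.
Qed.

Lemma Jker_involution_entries (a : nat -> R) (b : nat -> C) (S : R) (m p : nat) :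
  setting a b S ->
  csum (fun n => (Jker a b m n * Jker a b n p)%C) = if Nat.eq_dec m p then RtoC 1 else RtoC 0.
Proof.
  intros H. pose proof (set_b0 _ _ _ H) as B0. pose proof (set_pos _ _ _ H) as P.
  set (g := fun n => RtoC (a p * pi_seq a p * (a n * pi_seq a n / ((a n + a m) * (a n + a p))))).
  assert (E : forall n, (Jker a b m n * Jker a b n p)%C = (b m / b p * g n)%C).
  { intro n. unfold g, Jker.
    replace (a p * pi_seq a p * (a n * pi_seq a n / ((a n + a m) * (a n + a p))))
      with (a n * pi_seq a n / (a m + a n) * (a p * pi_seq a p / (a n + a p))).
    2:{ pose proof (P n); pose proof (P m); pose proof (P p). field. lra. }
    rewrite RtoC_mult. field. split; apply B0. }
  assert (A : asum (fun n => (Jker a b m n * Jker a b n p)%C)).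
  { apply kmul_asum with S; [apply (set_J _ _ _ H)|]. exists S. intro n.
    destruct (schur_row _ S n (set_J _ _ _ H)) as [Er L]. eapply Rle_trans; [|apply L].
    apply (term_le_Series (fun m => Cmod (Jker a b n m))); auto. intro; apply Cmod_ge_0. }
  rewrite (csum_ext _ _ E), csum_scal.
  - unfold g. rewrite csum_RtoC, Series_scal_l, pi_sum_involution; try apply H.
    destruct (Nat.eq_dec m p) as [->|D]; [field; apply B0|ring].
  - apply (asum_scal (b p / b m)) in A. revert A. unfold asum. apply ex_series_ext. intro n.
    f_equal. rewrite E. field. split; apply B0.
Qed.

Lemma csum_single (z : C) (p : nat) : csum (fun m => if Nat.eq_dec m p then z else RtoC 0) = z.
Proof.
  assert (R : forall (r : R) (f : nat -> R), (forall m, f m = if Nat.eq_dec m p then r else 0) -> Series f = r).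
  { intros r f Hf. rewrite (Series_ext _ (fun m => if le_dec m p then f m else 0)).
    - rewrite Series_trunc. assert (Hp : f p = r) by (rewrite Hf; now destruct (Nat.eq_dec p p)).
      destruct p as [|p]; simpl; [auto|]. rewrite sum_eq_R0, Hp; [ring|].
      intros n Hn. rewrite Hf. destruct (Nat.eq_dec n (S p)); [lia|auto].
    - intro m. rewrite Hf. destruct (le_dec m p), (Nat.eq_dec m p); auto; lia. }
  destruct z as [x y]. unfold csum. f_equal; apply R; intro m; now destruct (Nat.eq_dec m p).
Qed.

(** On finitely supported sequences the involution follows from its entries by linearity, one
    coordinate at a time; this replaces an exchange of double series. *)
Lemma kmul_trunc_involution (a : nat -> R) (b : nat -> C) (S : R) (u : nat -> C) (m N : nat) :
  setting a b S ->
  kmul (Jker a b) (kmul (Jker a b) (fun p => if lt_dec p N then u p else RtoC 0)) m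
  = if lt_dec m N then u m else RtoC 0.
Proof.
  intro H. pose proof (set_J _ _ _ H) as HJ.
  assert (Bd : forall v, bounded_seq v -> bounded_seq (kmul (Jker a b) v)).
  { intros v [M HM]. exists (S * M). intro n. now apply kmul_Cmod_le. }
  assert (Z : bounded_seq (fun _ => RtoC 0)) by (exists 0; intro; rewrite Cmod_0; lra).
  induction N as [|N IH].
  - assert (E0 : kmul (Jker a b) (fun _ => RtoC 0) = fun _ => RtoC 0).
    { apply functional_extensionality. intro n.
      etransitivity; [|apply (csum_single 0 0)]. apply csum_ext. intro q.
      destruct (Nat.eq_dec q 0); apply Cmult_0_r. }
    replace (fun p : nat => if lt_dec p 0 then u p else RtoC 0) with (fun _ : nat => RtoC 0).
    2:{ apply functional_extensionality; intro p. destruct (lt_dec p 0); [lia|auto]. }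
    now rewrite !E0.
  - set (d := fun m => if Nat.eq_dec m N then RtoC 1 else RtoC 0).
    assert (Hd : bounded_seq d).
    { exists 1. intro n. unfold d. destruct (Nat.eq_dec n N); rewrite ?Cmod_1, ?Cmod_0; lra. }
    assert (Ht : bounded_seq (fun p => if lt_dec p N then u p else RtoC 0)).
    { clear IH. induction N as [|N IHN].
      - exists 0. intro n. destruct (lt_dec n 0); [lia|]. rewrite Cmod_0; lra.
      - destruct IHN as [M HM].
        { exists 1. intro n. destruct (Nat.eq_dec n N); rewrite ?Cmod_1, ?Cmod_0; lra. }
        exists (Rmax M (Cmod (u N))). intro n. specialize (HM n).
        destruct (Nat.eq_dec n N) as [->|D].
        + destruct (lt_dec N (Datatypes.S N)); [apply Rmax_r|lia].
        + eapply Rle_trans; [|apply Rmax_l].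
          destruct (lt_dec n N), (lt_dec n (Datatypes.S N)); auto; try lia. }
    assert (E : (fun p => if lt_dec p (Datatypes.S N) then u p else RtoC 0)
      = (fun p => ((if lt_dec p N then u p else RtoC 0) + u N * d p)%C)).
    { apply functional_extensionality; intro p. unfold d.
      destruct (lt_dec p N), (lt_dec p (Datatypes.S N)), (Nat.eq_dec p N); subst; try lia; ring. }
    assert (Hs : bounded_seq (fun p => (u N * d p)%C)).
    { destruct Hd as [M HM]. exists (Cmod (u N) * M). intro n. rewrite Cmod_mult.
      apply Rmult_le_compat_l; auto. apply Cmod_ge_0. }
    assert (Dk : forall n, kmul (Jker a b) d n = Jker a b n N).
    { intro n. unfold kmul. rewrite <- (csum_single (Jker a b n N) N) at 1.
      apply csum_ext. intro q. unfold d. destruct (Nat.eq_dec q N) as [->|]; ring. }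
    rewrite E.
    replace (kmul (Jker a b) (fun p => ((if lt_dec p N then u p else RtoC 0) + u N * d p)%C))
      with (fun n => (kmul (Jker a b) (fun p => if lt_dec p N then u p else RtoC 0) n
                      + u N * kmul (Jker a b) d n)%C).
    2:{ apply functional_extensionality; intro n.
        rewrite (kmul_plus _ S) by auto. now rewrite (kmul_scal _ S) by auto. }
    rewrite (kmul_plus _ S); auto.
    2:{ destruct (Bd d Hd) as [M HM]. exists (Cmod (u N) * M). intro n. rewrite Cmod_mult.
        apply Rmult_le_compat_l; auto. apply Cmod_ge_0. }
    rewrite (kmul_scal _ S) by auto. rewrite IH.
    replace (kmul (Jker a b) (kmul (Jker a b) d) m) with (if Nat.eq_dec m N then RtoC 1 else RtoC 0).
    2:{ rewrite <- (Jker_involution_entries a b S m N H). apply csum_ext. intro n. now rewrite Dk. }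
    destruct (lt_dec m N), (lt_dec m (Datatypes.S N)), (Nat.eq_dec m N); subst; try lia; ring.
Qed.

(** Summable rows make [K] continuous for bounded coordinatewise convergence, by Tannery with
    majorant [M * Cmod (K n m)]. *)
Lemma cconv_kmul (K : nat -> nat -> C) (S M : R) (f : nat -> nat -> C) (l : nat -> C) (n : nat) :
  schur K S -> (forall N m, Cmod (f N m) <= M) -> (forall m, cconv (fun N => f N m) (l m)) ->
  cconv (fun N => kmul K (f N) n) (kmul K l n).
Proof.
  intros HK HM Hl.
  apply (tannery_C (fun N m => (K n m * f N m)%C) _ (fun m => M * Cmod (K n m))).
  - apply ex_series_scalR, (schur_row K S n HK).
  - intros N m. rewrite Cmod_mult, Rmult_comm. apply Rmult_le_compat_r; auto. apply Cmod_ge_0.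
  - intro m. specialize (Hl m). unfold cconv in *.
    apply is_lim_seq_ext with (fun N => Cmod (K n m) * Cmod (f N m - l m)%C).
    + intro N. rewrite <- Cmod_mult. f_equal. ring.
    + replace (Finite 0) with (Rbar_mult (Cmod (K n m)) 0) by (simpl; f_equal; ring).
      now apply is_lim_seq_scal_l.
Qed.

Lemma cconv_eventually (u : nat -> C) (l : C) (N : nat) :
  (forall n, (N <= n)%nat -> u n = l) -> cconv u l.
Proof.
  intro H. apply is_lim_seq_ext_loc with (fun _ => 0); [|apply is_lim_seq_const].
  exists N. intros n L. rewrite H by auto. replace (l - l)%C with (RtoC 0) by ring.
  now rewrite Cmod_0.
Qed.

(** Truncations of [u] converge coordinatewise under a common bound, even where they fail to
    converge in norm. Two uses of [cconv_kmul] carry the limit through both factors [J], the second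
    with bound [S * M]. *)
Lemma J_involution (a : nat -> R) (b : nat -> C) (S : R) (u : nat -> C) :
  setting a b S -> bounded_seq u -> kmul (Jker a b) (kmul (Jker a b) u) = u.
Proof.
  intros H [M HM]. apply functional_extensionality; intro m.
  set (f := fun N p => if lt_dec p N then u p else RtoC 0).
  assert (M0 : 0 <= M) by (eapply Rle_trans; [apply Cmod_ge_0|apply (HM O)]).
  assert (Hf : forall N p, Cmod (f N p) <= M).
  { intros N p. unfold f. destruct (lt_dec p N); auto. now rewrite Cmod_0. }
  apply (cconv_unique (fun N => kmul (Jker a b) (kmul (Jker a b) (f N)) m)).
  - apply (cconv_kmul _ S (S * M)); [apply H| |].
    + intros N n. apply kmul_Cmod_le; auto. apply H.
    + intro n. apply (cconv_kmul _ S M); auto; [apply H|].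
      intro p. apply (cconv_eventually _ _ (Datatypes.S p)). intros N L. unfold f.
      destruct (lt_dec p N); [auto|lia].
  - apply (cconv_eventually _ _ (Datatypes.S m)). intros N L. unfold f.
    rewrite (kmul_trunc_involution a b S u m N H). destruct (lt_dec m N); [auto|lia].
Qed.

(** In [Jker a b n m * b m] the factor [b m] cancels, leaving [b n] times the series of [pi_sum]. *)
Lemma J_b (a : nat -> R) (b : nat -> C) (S : R) (n : nat) :
  setting a b S -> kmul (Jker a b) b n = b n.
Proof.
  intro H. pose proof (set_pos _ _ _ H) as P. pose proof (set_b0 _ _ _ H) as B0.
  assert (A := kmul_asum _ S b n (set_J _ _ _ H) (set_bb _ _ _ H)).
  set (g := fun m => RtoC (a m * pi_seq a m / (a m + a n))).
  assert (E : forall m, (Jker a b n m * b m)%C = (b n * g m)%C).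
  { intro m. unfold Jker, g. rewrite (Rplus_comm (a n)). field. apply B0. }
  unfold kmul. rewrite (csum_ext _ _ E), csum_scal.
  - unfold g. rewrite csum_RtoC, pi_sum by apply H. ring.
  - apply (asum_scal (/ b n)) in A. revert A. unfold asum. apply ex_series_ext. intro m.
    f_equal. rewrite E. field. apply B0.
Qed.

Lemma k_asum (a : nat -> R) (b : nat -> C) (S : R) (x : nat -> C) :
  setting a b S -> bounded_seq x -> asum (fun m => (k_ma a b m * x m)%C).
Proof.
  intros H [M HM]. apply asum_dom with (fun m => M * Cmod (k_ma a b m)).
  - apply ex_series_scalR, H.
  - intro m. rewrite Cmod_mult, Rmult_comm. apply Rmult_le_compat_r; auto. apply Cmod_ge_0.
Qed.

Lemma a_le_a0 (a : nat -> R) (n : nat) : (forall n, a (S n) < a n) -> a n <= a 0%nat.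
Proof. intro H. destruct n as [|n]; [lra|]. left. apply decr_lt; auto; lia. Qed.

Lemma diag_bounded (c : nat -> R) (B : R) (x : nat -> C) :
  (forall n, Rabs (c n) <= B) -> bounded_seq x -> bounded_seq (fun n => (RtoC (c n) * x n)%C).
Proof.
  intros HB [M HM]. exists (B * M). intro n. rewrite Cmod_mult, Cmod_R.
  apply Rmult_le_compat; auto; [apply Rabs_pos|apply Cmod_ge_0].
Qed.

Lemma scal_bounded (c : C) (x : nat -> C) : bounded_seq x -> bounded_seq (fun n => (c * x n)%C).
Proof.
  intros [M HM]. exists (Cmod c * M). intro n. rewrite Cmod_mult.
  apply Rmult_le_compat_l; auto. apply Cmod_ge_0.
Qed.

Lemma plus_bounded (x y : nat -> C) :
  bounded_seq x -> bounded_seq y -> bounded_seq (fun n => (x n + y n)%C).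
Proof.
  intros [M HM] [N HN]. exists (M + N). intro n. eapply Rle_trans; [apply Cmod_triangle|].
  now apply Rplus_le_compat.
Qed.

Lemma a_abs_le (a : nat -> R) (b : nat -> C) (S : R) (n : nat) :
  setting a b S -> Rabs (a n) <= a 0%nat.
Proof.
  intro H. rewrite Rabs_pos_eq by (left; apply H). apply a_le_a0, H.
Qed.

Lemma T_bounded (a : nat -> R) (b : nat -> C) (S : R) (x : nat -> C) :
  setting a b S -> bounded_seq x -> bounded_seq (Tk a b (k_ma a b) x).
Proof.
  intros H Hx. unfold Tk. apply plus_bounded.
  - apply (diag_bounded a (a 0%nat)); auto. intro n. now apply (a_abs_le a b S).
  - apply scal_bounded, H.
Qed.

Lemma J_T (a : nat -> R) (b : nat -> C) (S : R) (x : nat -> C) (n : nat) :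
  setting a b S -> bounded_seq x ->
  kmul (Jker a b) (Tk a b (k_ma a b) x) n = (- RtoC (a n) * kmul (Jker a b) x n)%C.
Proof.
  intros H Hx. pose proof (set_J _ _ _ H) as HJ. pose proof (set_b0 _ _ _ H) as B0.
  assert (Ha : bounded_seq (fun m => (RtoC (a m) * x m)%C)).
  { apply (diag_bounded a (a 0%nat)); auto. intro m. now apply (a_abs_le a b S). }
  unfold Tk. rewrite (kmul_plus _ S), (kmul_scal _ S), (J_b a b S) by
    (auto; try apply scal_bounded; apply H).
  set (s := csum (fun m => (k_ma a b m * x m)%C)).
  (* The Sylvester equation applied to [x]: the factor [a n + a m] clears the denominator of the
     kernel and leaves [- b n * k_ma a b m]. *)
  assert (E : (kmul (Jker a b) (fun m => (RtoC (a m) * x m)%C) n + RtoC (a n) * kmul (Jker a b) x n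
               = - b n * s)%C).
  { unfold kmul at 2. rewrite <- csum_scal by now apply kmul_asum with S.
    unfold kmul. rewrite <- csum_plus.
    - unfold s. rewrite <- csum_scal by now apply k_asum with S.
      apply csum_ext. intro m. unfold Jker, k_ma.
      replace (RtoC (a m * pi_seq a m / (a n + a m))) with (RtoC (a m) * RtoC (pi_seq a m) / (RtoC (a n) + RtoC (a m)))%C.
      + rewrite RtoC_mult, RtoC_opp. field. split; [apply B0|].
        rewrite <- RtoC_plus. intro Q. apply RtoC_inj in Q.
        pose proof (set_pos _ _ _ H n). pose proof (set_pos _ _ _ H m). lra.
      + pose proof (set_pos _ _ _ H n). pose proof (set_pos _ _ _ H m).
        unfold Rdiv, Cdiv. now rewrite !RtoC_mult, RtoC_inv, RtoC_plus by lra.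
    - now apply kmul_asum with S.
    - now apply asum_scal, kmul_asum with S. }
  replace (- RtoC (a n) * kmul (Jker a b) x n)%C
    with (kmul (Jker a b) (fun m => (RtoC (a m) * x m)%C) n - (- b n * s))%C.
  - ring.
  - rewrite <- E. ring.
Qed.

(** * The flow [J e^(-tA) J] *)

Definition decay (a : nat -> R) (t : R) (y : nat -> C) (n : nat) : C :=
  (RtoC (exp (- (t * a n))) * y n)%C.

Definition flow (a : nat -> R) (b x0 : nat -> C) (t : R) : nat -> C :=
  kmul (Jker a b) (decay a t (kmul (Jker a b) x0)).

Lemma kmul_bounded (K : nat -> nat -> C) (S : R) (u : nat -> C) :
  schur K S -> bounded_seq u -> bounded_seq (kmul K u).
Proof. intros HK [M HM]. exists (S * M). intro n. now apply kmul_Cmod_le. Qed.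

Lemma exp_neg_le (s : R) : 0 <= s -> 0 < exp (- s) <= 1.
Proof.
  intro H. split; [apply exp_pos|]. rewrite <- exp_0. destruct H as [H|<-].
  - left. apply exp_increasing. lra.
  - rewrite Ropp_0. lra.
Qed.

Lemma decay_Cmod_le (a : nat -> R) (s t : R) (y : nat -> C) (n : nat) :
  0 < a n -> s <= t -> Cmod (decay a t y n) <= Cmod (decay a s y n).
Proof.
  intros P L. unfold decay. rewrite !Cmod_mult, !Cmod_R, !Rabs_pos_eq by (left; apply exp_pos).
  apply Rmult_le_compat_r; [apply Cmod_ge_0|].
  replace (- (t * a n)) with (- (s * a n) + - ((t - s) * a n)) by ring.
  rewrite exp_plus. rewrite <- (Rmult_1_r (exp (- (s * a n)))) at 2.
  apply Rmult_le_compat_l; [left; apply exp_pos|]. apply exp_neg_le.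
  apply Rmult_le_pos; lra.
Qed.

Lemma decay_0 (a : nat -> R) (y : nat -> C) : decay a 0 y = y.
Proof.
  apply functional_extensionality; intro n. unfold decay.
  rewrite Rmult_0_l, Ropp_0, exp_0. ring.
Qed.

Lemma decay_le (a : nat -> R) (t : R) (y : nat -> C) (n : nat) :
  0 < a n -> 0 <= t -> Cmod (decay a t y n) <= 1 * Cmod (y n).
Proof.
  intros P Ht. rewrite Rmult_1_l.
  replace (y n) with (decay a 0 y n) by now rewrite decay_0.
  now apply decay_Cmod_le.
Qed.

Lemma decay_bounded (a : nat -> R) (t : R) (y : nat -> C) :
  (forall n, 0 < a n) -> 0 <= t -> bounded_seq y -> bounded_seq (decay a t y).
Proof.
  intros P Ht [M HM]. exists M. intro n. eapply Rle_trans; [apply decay_le; auto|].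
  rewrite Rmult_1_l. apply HM.
Qed.

(** Conjugate [J_T] by the involution: [T J = J (J T) J = - J A J J = - J A]. *)
Lemma T_J (a : nat -> R) (b : nat -> C) (S : R) (y : nat -> C) (n : nat) :
  setting a b S -> bounded_seq y ->
  Tk a b (k_ma a b) (kmul (Jker a b) y) n = kmul (Jker a b) (fun m => (- RtoC (a m) * y m)%C) n.
Proof.
  intros H Hy.
  assert (B : bounded_seq (kmul (Jker a b) y)) by (apply kmul_bounded with S; auto; apply H).
  rewrite <- (J_involution a b S (Tk a b (k_ma a b) _)) by (auto; now apply T_bounded with S).
  f_equal. apply functional_extensionality; intro m.
  rewrite (J_T a b S) by auto. now rewrite (J_involution a b S).
Qed.

(** The upper bound comes from [exp (- x) >= 1 - x], that is [exp x <= 1 / (1 - x)], which is at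
    most [1 + x + 2 x^2] for [x <= 1/2]. *)
Lemma exp_taylor1 (x : R) : Rabs x <= 1 / 2 -> Rabs (exp x - 1 - x) <= 2 * x ^ 2.
Proof.
  intro H. assert (Hx : - (1 / 2) <= x <= 1 / 2) by (now apply Rabs_le_between).
  pose proof (exp_ineq1_le x) as L1. pose proof (exp_ineq1_le (- x)) as L2.
  rewrite Rabs_pos_eq by lra.
  assert (E : exp x * exp (- x) = 1) by (rewrite <- exp_plus, Rplus_opp_r; apply exp_0).
  pose proof (exp_pos x).
  assert (exp x * (1 - x) <= 1) by (rewrite <- E; apply Rmult_le_compat_l; lra).
  assert (1 <= (1 + x + 2 * x ^ 2) * (1 - x)) by nra.
  assert (exp x <= 1 + x + 2 * x ^ 2) by (apply Rmult_le_reg_r with (1 - x); lra).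
  lra.
Qed.

Definition quotient_error (a t h : R) : R :=
  (exp (- ((t + h) * a)) - exp (- (t * a))) / h + a * exp (- (t * a)).

(** The estimate is uniform in [t] and explicit in [a]: uniformity over the coordinates yields
    differentiability in norm, and the power of [a] later yields membership in c_0. *)
Lemma quotient_error_le (a t h : R) :
  0 < a -> 0 <= t -> h <> 0 -> Rabs h * a <= 1 / 2 ->
  Rabs (quotient_error a t h) <= 2 * Rabs h * a ^ 2.
Proof.
  intros Pa Ht Hh L. unfold quotient_error.
  replace (- ((t + h) * a)) with (- (t * a) + - (h * a)) by ring. rewrite exp_plus.
  replace ((exp (- (t * a)) * exp (- (h * a)) - exp (- (t * a))) / h + a * exp (- (t * a)))
    with (exp (- (t * a)) * ((exp (- (h * a)) - 1 - - (h * a)) / h)) by (field; auto).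
  assert (X : Rabs (- (h * a)) <= 1 / 2) by (rewrite Rabs_Ropp, Rabs_mult, (Rabs_pos_eq a); lra).
  apply exp_taylor1 in X. rewrite Rabs_mult.
  destruct (exp_neg_le (t * a)) as [E1 E2]; [apply Rmult_le_pos; lra|].
  rewrite (Rabs_pos_eq (exp _)) by lra.
  apply Rle_trans with (1 * Rabs ((exp (- (h * a)) - 1 - - (h * a)) / h)).
  { apply Rmult_le_compat_r; [apply Rabs_pos|lra]. }
  rewrite Rmult_1_l. unfold Rdiv. rewrite Rabs_mult, Rabs_inv.
  assert (0 < Rabs h) by now apply Rabs_pos_lt.
  apply Rmult_le_reg_r with (Rabs h); auto. rewrite Rmult_assoc, Rinv_l, Rmult_1_r by lra.
  eapply Rle_trans; [exact X|]. right.
  replace ((- (h * a)) ^ 2) with (h ^ 2 * a ^ 2) by ring. rewrite <- (pow2_abs h). ring.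
Qed.

Lemma flow_error (a : nat -> R) (b x0 : nat -> C) (S t h : R) :
  setting a b S -> bounded_seq x0 -> 0 <= t -> h <> 0 -> 0 <= t + h ->
  (fun n => ((flow a b x0 (t + h) n - flow a b x0 t n) / RtoC h
             - Tk a b (k_ma a b) (flow a b x0 t) n)%C)
  = kmul (Jker a b) (fun n => (RtoC (quotient_error (a n) t h) * kmul (Jker a b) x0 n)%C).
Proof.
  intros H Hx Ht Hh Hth. apply functional_extensionality; intro n.
  pose proof (set_J _ _ _ H) as HJ.
  assert (By : bounded_seq (kmul (Jker a b) x0)) by now apply kmul_bounded with S.
  set (y := kmul (Jker a b) x0) in *.
  assert (B1 : bounded_seq (decay a (t + h) y)) by (apply decay_bounded; auto; apply H).
  assert (B2 : bounded_seq (decay a t y)) by (apply decay_bounded; auto; apply H).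
  assert (B3 : bounded_seq (fun m => (RtoC (a m) * decay a t y m)%C)).
  { apply (diag_bounded a (a 0%nat)); auto. intro m. now apply (a_abs_le a b S). }
  assert (Ch : RtoC h <> 0) by (intro Q; apply RtoC_inj in Q; auto).
  rewrite (csum_ext (fun m => (Jker a b n m * (RtoC (quotient_error (a m) t h) * y m))%C)
    (fun m => (Jker a b n m * (/ RtoC h * decay a (t + h) y m +
       (- / RtoC h * decay a t y m + 1 * (RtoC (a m) * decay a t y m))))%C)) at 1.
  - change (((flow a b x0 (t + h) n - flow a b x0 t n) / RtoC h
             - Tk a b (k_ma a b) (flow a b x0 t) n)%C =
       kmul (Jker a b) (fun m => (/ RtoC h * decay a (t + h) y m +
       (- / RtoC h * decay a t y m + 1 * (RtoC (a m) * decay a t y m)))%C) n).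
    unfold flow. fold y. rewrite (T_J a b S) by auto.
    rewrite (kmul_plus _ S) by (auto using scal_bounded, plus_bounded).
    rewrite (kmul_plus _ S) by (auto using scal_bounded).
    rewrite !(kmul_scal _ S) by auto.
    replace (kmul (Jker a b) (fun m => (- RtoC (a m) * decay a t y m)%C) n)
      with (- (1) * kmul (Jker a b) (fun m => (RtoC (a m) * decay a t y m)%C) n)%C.
    + field. auto.
    + rewrite <- (kmul_scal _ S) by auto. apply csum_ext. intro m. ring.
  - intro m. unfold decay, quotient_error.
    replace (RtoC ((exp (- ((t + h) * a m)) - exp (- (t * a m))) / h + a m * exp (- (t * a m))))
      with ((RtoC (exp (- ((t + h) * a m))) - RtoC (exp (- (t * a m)))) / RtoC h
            + RtoC (a m) * RtoC (exp (- (t * a m))))%C.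
    + field. auto.
    + unfold Rdiv. now rewrite RtoC_plus, !RtoC_mult, RtoC_minus, RtoC_inv.
Qed.

Lemma flow_0 (a : nat -> R) (b x0 : nat -> C) (S : R) :
  setting a b S -> bounded_seq x0 -> flow a b x0 0 = x0.
Proof. intros H Hx. unfold flow. rewrite decay_0. now apply J_involution with S. Qed.

(** The difference is [J] applied to [(e^(-tA) - I) J x0], whose entries are at most [t * a n] times
    a constant. This gives both the invariance of c and the failure of decay on c and l^oo. *)
Lemma flow_minus_C0 (a : nat -> R) (b x0 : nat -> C) (S t : R) :
  setting a b S -> bounded_seq x0 -> 0 <= t ->
  cconv (fun n => (flow a b x0 t n - x0 n)%C) 0.
Proof.
  intros H Hx Ht. pose proof (set_J _ _ _ H) as HJ.
  assert (By : bounded_seq (kmul (Jker a b) x0)) by now apply kmul_bounded with S.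
  set (y := kmul (Jker a b) x0) in *.
  assert (Bd : bounded_seq (decay a t y)) by (apply decay_bounded; auto; apply H).
  replace (fun n => (flow a b x0 t n - x0 n)%C)
    with (kmul (Jker a b) (fun n => (decay a t y n + -(1) * y n)%C)).
  2:{ apply functional_extensionality; intro n.
      rewrite (kmul_plus _ S), (kmul_scal _ S) by (auto using scal_bounded).
      unfold y at 2. rewrite (J_involution a b S) by auto. unfold flow. fold y. ring. }
  apply schur_C0 with S; auto; [apply H|].
  destruct By as [M HM].
  assert (M0 : 0 <= M) by (eapply Rle_trans; [apply Cmod_ge_0|apply (HM O)]).
  apply cconv0_le with (fun n => t * M * a n).
  - intro n. unfold decay.
    replace (RtoC (exp (- (t * a n))) * y n + -(1) * y n)%C with (RtoC (exp (- (t * a n)) - 1) * y n)%C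
      by (rewrite RtoC_minus; ring).
    pose proof (set_pos _ _ _ H n).
    assert (0 <= t * a n) by (apply Rmult_le_pos; lra).
    rewrite Cmod_mult, Cmod_R. destruct (exp_neg_le (t * a n)); auto.
    pose proof (exp_ineq1_le (- (t * a n))).
    rewrite Rabs_left1 by lra. replace (t * M * a n) with (t * a n * M) by ring.
    apply Rmult_le_compat; auto; [lra|apply Cmod_ge_0|lra].
  - replace (Finite 0) with (Rbar_mult (t * M) 0) by (simpl; f_equal; ring).
    apply is_lim_seq_scal_l. apply H.
Qed.

(** The solid space in which the estimates for [X] are made; its norm is that of [X]. *)
Definition hull (X : space) : space := match X with Cc => Linf | _ => X end.

Lemma hull_valid (X : space) : valid_space X -> valid_space (hull X).
Proof. now destruct X. Qed.

Lemma hull_solid (X : space) : solid (hull X).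
Proof. now destruct X. Qed.

Lemma hull_inX (X : space) (u : nat -> C) : inX X u -> inX (hull X) u.
Proof. destruct X; simpl; auto. intros [l H]. now apply cconv_bounded with l. Qed.

Lemma hull_norm (X : space) (u : nat -> C) : normX (hull X) u = normX X u.
Proof. now destruct X. Qed.

Lemma cconv_plus (u v : nat -> C) (l l' : C) :
  cconv u l -> cconv v l' -> cconv (fun n => (u n + v n)%C) (l + l')%C.
Proof.
  intros H H'. apply cconv_Re_Im in H, H'. apply cconv_Re_Im.
  split; apply is_lim_seq_plus'; tauto.
Qed.

Lemma decay_norm (X : space) (a : nat -> R) (y : nat -> C) (t : R) :
  valid_space X -> solid X -> (forall n, 0 < a n) -> 0 <= t -> inX X y ->
  inX X (decay a t y) /\ normX X (decay a t y) <= normX X y.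
Proof.
  intros V Sol P Ht Hy. rewrite <- (Rmult_1_l (normX X y)).
  apply solid_le; auto; [lra|]. intro n. now apply decay_le.
Qed.

Lemma flow_inX (X : space) (a : nat -> R) (b x0 : nat -> C) (S t : R) :
  valid_space X -> setting a b S -> inX X x0 -> 0 <= t -> inX X (flow a b x0 t).
Proof.
  intros V H Hx Ht.
  assert (Gen : solid X -> inX X (flow a b x0 t)).
  { intro Sol. apply (schur_bounded (Jker a b) S X); auto; try apply H.
    apply decay_norm; auto; [apply H|]. apply (schur_bounded (Jker a b) S X); auto; apply H. }
  destruct X; try (apply Gen; exact I).
  (* On c the flow keeps the limit of the initial state; [0 + l] is the form given by
     [cconv_plus]. *)
  destruct Hx as [l Hl]. exists (0 + l)%C.
  replace (flow a b x0 t) with (fun n => ((flow a b x0 t n - x0 n) + x0 n)%C).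
  - apply cconv_plus; auto. apply flow_minus_C0 with S; auto. now apply cconv_bounded with l.
  - apply functional_extensionality; intro n. ring.
Qed.

Lemma flow_solution (X : space) (a : nat -> R) (b x0 : nat -> C) (S : R) :
  valid_space X -> setting a b S -> inX X x0 ->
  solution X (Tk a b (k_ma a b)) (flow a b x0).
Proof.
  intros V H Hx. split; [intros; now apply flow_inX with S|].
  intros t Ht eps He. pose proof (set_J _ _ _ H) as HJ. pose proof (set_S _ _ _ H) as HS.
  assert (Bx : bounded_seq x0) by now apply inX_bounded with X.
  destruct (schur_bounded (Jker a b) S (hull X) x0) as [Hy _];
    auto using hull_valid, hull_solid, hull_inX.
  set (y := kmul (Jker a b) x0) in *. set (N := normX (hull X) y).
  assert (N0 : 0 <= N) by (apply normX_nonneg; auto using hull_valid).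
  pose proof (set_pos _ _ _ H 0%nat) as P0.
  set (c := 2 * a 0%nat ^ 2 * S * N).
  assert (Hc : 0 <= c).
  { unfold c. repeat apply Rmult_le_pos; lra. }
  (* The first bound gives [Rabs h * a n <= 1/2] for all [n] at once, as [quotient_error_le]
     requires; the second makes [Rabs h * c] less than [eps], with [c + 1] allowing [c = 0]. *)
  exists (Rmin (/ (2 * a 0%nat)) (eps / (c + 1))). split.
  { apply Rmin_pos; [apply Rinv_0_lt_compat; lra|apply Rdiv_lt_0_compat; lra]. }
  intros h Hh Hd Hth. cbv zeta. rewrite (flow_error a b x0 S t h) by auto. fold y.
  pose proof (Rlt_le_trans _ _ _ Hd (Rmin_l _ _)) as D1.
  pose proof (Rlt_le_trans _ _ _ Hd (Rmin_r _ _)) as D2.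
  assert (Ph : 0 < Rabs h) by now apply Rabs_pos_lt.
  (* Only one of the two factors [a n] is replaced by [a 0]; the other one puts the residual in c_0
     when [X] is c. *)
  assert (Q : forall n, Rabs (quotient_error (a n) t h) <= 2 * Rabs h * a 0%nat * a n).
  { intro n. pose proof (set_pos _ _ _ H n). pose proof (a_le_a0 a n (set_decr _ _ _ H)).
    eapply Rle_trans; [apply quotient_error_le; auto|].
    - apply Rle_trans with (/ (2 * a 0%nat) * a 0%nat).
      + apply Rmult_le_compat; lra.
      + right. field. lra.
    - replace (a n ^ 2) with (a n * a n) by ring. rewrite <- Rmult_assoc.
      apply Rmult_le_compat_r; [lra|]. apply Rmult_le_compat_l; lra. }
  set (d := fun n => (RtoC (quotient_error (a n) t h) * y n)%C).
  destruct (solid_le (hull X) (2 * Rabs h * a 0%nat ^ 2) d y) as [Id Nd];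
    auto using hull_valid, hull_solid.
  { repeat apply Rmult_le_pos; lra. }
  { intro n. unfold d. rewrite Cmod_mult, Cmod_R. apply Rmult_le_compat_r; [apply Cmod_ge_0|].
    eapply Rle_trans; [apply Q|]. pose proof (a_le_a0 a n (set_decr _ _ _ H)).
    replace (2 * Rabs h * a 0%nat ^ 2) with (2 * Rabs h * a 0%nat * a 0%nat) by ring.
    apply Rmult_le_compat_l; auto. repeat apply Rmult_le_pos; lra. }
  destruct (schur_bounded (Jker a b) S (hull X) d) as [Ir Nr]; auto using hull_valid, hull_solid.
  split.
  - destruct X; auto. exists (RtoC 0). apply schur_C0 with S; auto.
    destruct Hy as [M HM].
    apply cconv0_le with (fun n => 2 * Rabs h * a 0%nat * M * a n).
    + intro n. unfold d. rewrite Cmod_mult, Cmod_R.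
      replace (2 * Rabs h * a 0%nat * M * a n) with (2 * Rabs h * a 0%nat * a n * M) by ring.
      apply Rmult_le_compat; auto; [apply Rabs_pos|apply Cmod_ge_0].
    + replace (Finite 0) with (Rbar_mult (2 * Rabs h * a 0%nat * M) 0) by (simpl; f_equal; ring).
      apply is_lim_seq_scal_l. apply H.
  - rewrite <- hull_norm. eapply Rle_lt_trans; [exact Nr|].
    apply Rle_lt_trans with (Rabs h * c).
    + unfold c. fold N in Nd.
      replace (Rabs h * (2 * a 0%nat ^ 2 * S * N)) with (S * (2 * Rabs h * a 0%nat ^ 2 * N)) by ring.
      apply Rmult_le_compat_l; lra.
    + apply Rle_lt_trans with (Rabs h * (c + 1)).
      * apply Rmult_le_compat_l; lra.
      * replace eps with (eps / (c + 1) * (c + 1)) by (field; lra).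
        apply Rmult_lt_compat_r; lra.
Qed.

(** * Uniqueness *)

(** Integrating factor: [exp (s * a) * f s] has derivative 0, so its values at 0 and [t] agree. *)
Lemma exp_ode_R (f : R -> R) (a : R) :
  (forall t, 0 <= t -> forall eps, 0 < eps -> exists delta, 0 < delta /\
     forall h, h <> 0 -> Rabs h < delta -> 0 <= t + h ->
       Rabs ((f (t + h) - f t) / h + a * f t) < eps) ->
  forall t, 0 <= t -> f t = exp (- (t * a)) * f 0.
Proof.
  intros Hf.
  (* Extending f affinely to t < 0 makes the derivative at 0 two-sided. *)
  set (F := fun s => if Rle_dec 0 s then f s else f 0 - a * f 0 * s).
  assert (FP : forall s, 0 <= s -> F s = f s) by (intros s Hs; unfold F; destruct (Rle_dec 0 s); lra).
  assert (D : forall t, 0 <= t -> is_derive F t (- (a * F t))).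
  { intros t Ht. apply is_derive_Reals. intros eps He.
    destruct (Hf t Ht eps He) as [d [Hd Hq]].
    (* For [t > 0] the step is kept below [t], so that [t + h] never reaches the affine
       extension. *)
    assert (Hd' : 0 < (if Rlt_dec 0 t then Rmin d t else d)).
    { destruct (Rlt_dec 0 t); auto. now apply Rmin_pos. }
    exists (mkposreal _ Hd'). simpl. intros h Hh Hl. rewrite (FP t Ht).
    destruct (Rle_dec 0 (t + h)) as [L|L].
    - rewrite FP by auto. unfold Rminus at 1. rewrite Ropp_involutive. apply Hq; auto.
      destruct (Rlt_dec 0 t); auto. eapply Rlt_le_trans; [exact Hl|apply Rmin_l].
    - destruct (Rlt_dec 0 t) as [Pt|Pt].
      + pose proof (Rlt_le_trans _ _ _ Hl (Rmin_r _ _)). apply Rabs_def2 in H. lra.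
      + assert (t = 0) by lra. subst t. unfold F. destruct (Rle_dec 0 (0 + h)); [easy|].
        replace ((f 0 - a * f 0 * (0 + h) - f 0) / h - - (a * f 0)) with 0 by (field; auto).
        now rewrite Rabs_R0. }
  intros t [Ht|<-]; [|rewrite Rmult_0_l, Ropp_0, exp_0; ring].
  assert (E : (fun s => exp (s * a) * F s) 0 = (fun s => exp (s * a) * F s) t).
  { apply (eq_is_derive (V := R_NormedModule) (fun s => exp (s * a) * F s)); auto. intros s Hs.
    replace (@zero R_NormedModule) with (a * exp (s * a) * F s + exp (s * a) * (- (a * F s)))
      by (change (@zero R_NormedModule) with 0; ring).
    apply (is_derive_mult (fun s => exp (s * a)) F s).
    - auto_derive; auto. ring.
    - apply D; lra.
    - intros; apply Rmult_comm. }
  cbv beta in E. rewrite !FP, Rmult_0_l, exp_0 in E by lra.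
  rewrite exp_Ropp. rewrite <- (Rmult_1_l (f 0)), E. field. apply Rgt_not_eq, exp_pos.
Qed.

Lemma exp_ode_C (f : R -> C) (a : R) :
  (forall t, 0 <= t -> forall eps, 0 < eps -> exists delta, 0 < delta /\
     forall h, h <> 0 -> Rabs h < delta -> 0 <= t + h ->
       Cmod ((f (t + h)%R - f t) / RtoC h + RtoC a * f t)%C < eps) ->
  forall t, 0 <= t -> f t = (RtoC (exp (- (t * a))) * f 0)%C.
Proof.
  intros Hf t Ht.
  assert (E : forall z w : C, forall h, h <> 0 ->
     (z / RtoC h + RtoC a * w)%C = (Re z / h + a * Re w, Im z / h + a * Im w)).
  { intros [z1 z2] [w1 w2] h Hh. unfold Cdiv. rewrite <- RtoC_inv by auto.
    unfold Cplus, Cmult, RtoC; simpl. f_equal; field; auto. }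
  assert (R1 : Re (f t) = exp (- (t * a)) * Re (f 0)).
  { apply (exp_ode_R (fun s => Re (f s))); auto. intros s Hs eps He.
    destruct (Hf s Hs eps He) as [d [Hd Hq]]. exists d. split; auto. intros h Hh Hl Hp.
    specialize (Hq h Hh Hl Hp). rewrite E in Hq by auto.
    eapply Rle_lt_trans; [|exact Hq]. eapply Rle_trans; [|apply re_le_Cmod]. simpl. right; f_equal. }
  assert (R2 : Im (f t) = exp (- (t * a)) * Im (f 0)).
  { apply (exp_ode_R (fun s => Im (f s))); auto. intros s Hs eps He.
    destruct (Hf s Hs eps He) as [d [Hd Hq]]. exists d. split; auto. intros h Hh Hl Hp.
    specialize (Hq h Hh Hl Hp). rewrite E in Hq by auto.
    eapply Rle_lt_trans; [|exact Hq]. eapply Rle_trans; [|apply im_le_Cmod]. simpl. right; f_equal. }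
  destruct (f t) as [u v], (f 0) as [u0 v0]. simpl in *. rewrite R1, R2.
  unfold Cmult, RtoC; simpl. f_equal; ring.
Qed.

(** By [J_T], each coordinate of [J x] solves the scalar equation [y' = - a_n y]: its residual is
    the coordinate of [J r], at most [S] times the norm of the residual [r] of [x]. Applying [J]
    once more recovers [x t]. *)
Lemma solution_flow (X : space) (a : nat -> R) (b : nat -> C) (S : R) (x : R -> nat -> C) (t : R) :
  valid_space X -> setting a b S -> solution X (Tk a b (k_ma a b)) x -> 0 <= t ->
  x t = flow a b (x 0) t.
Proof.
  intros V H [Hx Hd] Ht. pose proof (set_J _ _ _ H) as HJ. pose proof (set_S _ _ _ H) as HS.
  assert (Bx : forall s, 0 <= s -> bounded_seq (x s)) by (intros; apply inX_bounded with X; auto).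
  rewrite <- (J_involution a b S (x t)) by auto. unfold flow. f_equal.
  apply functional_extensionality; intro n. unfold decay.
  apply (exp_ode_C (fun s => kmul (Jker a b) (x s) n)); auto.
  intros s Hs eps He. assert (He' : 0 < eps / S) by now apply Rdiv_lt_0_compat.
  destruct (Hd s Hs _ He') as [d [Pd Hq]]. exists d. split; auto. intros h Hh Hl Hp.
  specialize (Hq h Hh Hl Hp). cbv zeta in Hq.
  set (r := fun n => ((x (s + h)%R n - x s n) / RtoC h - Tk a b (k_ma a b) (x s) n)%C) in *.
  destruct Hq as [Ir Nr].
  assert (E : ((kmul (Jker a b) (x (s + h)%R) n - kmul (Jker a b) (x s) n) / RtoC h
     + RtoC (a n) * kmul (Jker a b) (x s) n)%C = kmul (Jker a b) r n).
  { assert (Ch : RtoC h <> 0) by (intro Q; apply RtoC_inj in Q; auto).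
    assert (BT : bounded_seq (Tk a b (k_ma a b) (x s))) by (apply T_bounded with S; auto).
    transitivity (kmul (Jker a b) (fun m => (/ RtoC h * x (s + h)%R m +
       (- / RtoC h * x s m + - (1) * Tk a b (k_ma a b) (x s) m))%C) n).
    - rewrite (kmul_plus _ S) by (auto using scal_bounded, plus_bounded).
      rewrite (kmul_plus _ S) by (auto using scal_bounded).
      rewrite !(kmul_scal _ S), (J_T a b S) by auto. field. auto.
    - apply csum_ext. intro m. unfold r. field. auto. }
  rewrite E.
  apply Rle_lt_trans with (S * normX X r).
  - apply kmul_Cmod_le; auto. intro m. now apply Cmod_le_normX.
  - replace eps with (S * (eps / S)) by (field; lra). now apply Rmult_lt_compat_l.
Qed.

(** * Stability *)

Lemma setting_stable (X : space) (a : nat -> R) (b : nat -> C) (S : R) :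
  valid_space X -> setting a b S -> stable X (Tk a b (k_ma a b)).
Proof.
  intros V H. pose proof (set_J _ _ _ H) as HJ. pose proof (set_S _ _ _ H) as HS.
  split.
  - intros x0 Hx. exists (flow a b x0). split; [now apply flow_solution with S|].
    apply flow_0 with S; auto. now apply inX_bounded with X.
  (* One factor [S] for each [J]; [decay] in between is a contraction. *)
  - exists (S * S). split; [now apply Rmult_lt_0_compat|]. intros x Sx t Ht.
    rewrite (solution_flow X a b S x t) by auto.
    assert (I0 : inX (hull X) (x 0)) by (apply hull_inX, Sx; lra).
    rewrite <- (hull_norm X (x 0)), <- (hull_norm X (flow _ _ _ _)).
    destruct (schur_bounded (Jker a b) S (hull X) (x 0)) as [Iy Ny]; auto using hull_valid, hull_solid.
    destruct (decay_norm (hull X) a (kmul (Jker a b) (x 0)) t) as [Id Nd];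
      auto using hull_valid, hull_solid; [apply H|].
    destruct (schur_bounded (Jker a b) S (hull X) _ (hull_valid X V) (hull_solid X) HS HJ Id) as [_ Nf].
    eapply Rle_trans; [exact Nf|]. rewrite Rmult_assoc. apply Rmult_le_compat_l; lra.
Qed.

Lemma decay_tendsto_0 (X : space) (a : nat -> R) (y : nat -> C) :
  valid_space X -> X = C0 \/ (exists p, X = Lp p) ->
  (forall n, a (S n) < a n) -> (forall n, 0 < a n) -> inX X y ->
  forall eps, 0 < eps -> exists t0, 0 <= t0 /\ forall t, t0 <= t -> normX X (decay a t y) < eps.
Proof.
  intros V HX Ha P Hy eps He. destruct HX as [->|[p ->]].
  - pose proof (cconv0_Cmod y Hy) as Hl. apply is_lim_seq_spec in Hl.
    assert (e2 : 0 < eps / 2) by lra.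
    destruct (Hl (mkposreal _ e2)) as [N HN]. simpl in HN.
    destruct (cconv_bounded _ _ Hy) as [M HM].
    assert (M0 : 0 <= M) by (eapply Rle_trans; [apply Cmod_ge_0|apply (HM O)]).
    pose proof (P N) as PN.
    (* For [n < N], [a n] exceeds [a N], so from this time on [t * a n >= M / (eps / 2)], and
       [exp s >= 1 + s] brings the head below [eps / 2]. The tail is already small at time 0. *)
    exists (M / (a N * (eps / 2))).
    assert (T0 : 0 <= M / (a N * (eps / 2))).
    { apply Rdiv_le_0_compat; auto. now apply Rmult_lt_0_compat. }
    split; auto. intros t Ht.
    apply Rle_lt_trans with (eps / 2); [|lra]. apply supnorm_le. intro n.
    destruct (le_lt_dec N n) as [L|L].
    + specialize (HN n L). rewrite Rminus_0_r, Rabs_pos_eq in HN by apply Cmod_ge_0.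
      eapply Rle_trans; [apply decay_le; auto; lra|]. lra.
    + assert (Hn : a N < a n) by now apply decr_lt.
      unfold decay. rewrite Cmod_mult, Cmod_R, Rabs_pos_eq by (left; apply exp_pos).
      assert (Z : M <= eps / 2 * (t * a n)).
      { apply Rle_trans with (eps / 2 * (M / (a N * (eps / 2)) * a N)).
        - right. field. lra.
        - apply Rmult_le_compat_l; [lra|]. apply Rmult_le_compat; lra. }
      pose proof (exp_ineq1_le (t * a n)). rewrite exp_Ropp.
      apply Rmult_le_reg_l with (exp (t * a n)); [apply exp_pos|].
      rewrite <- Rmult_assoc, Rinv_r, Rmult_1_l by apply Rgt_not_eq, exp_pos.
      specialize (HM n). nra.
  - simpl in V.
    (* At integer times each term is a geometric sequence in [j], to which dominated convergence for
       sequences applies; monotonicity in [t] covers the remaining times. *)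
    assert (E : forall (j n : nat), rpow (Cmod (decay a (INR j) y n)) p
       = exp (- (a n * p)) ^ j * rpow (Cmod (y n)) p).
    { intros j n. unfold decay. rewrite Cmod_mult, Cmod_R, Rabs_pos_eq by (left; apply exp_pos).
      rewrite rpow_mult by (try apply Cmod_ge_0; left; apply exp_pos). f_equal.
      rewrite rpow_pos by apply exp_pos. unfold Rpower. rewrite ln_exp.
      replace (p * - (INR j * a n)) with (INR j * - (a n * p)) by ring.
      induction j as [|j IH]; [simpl; rewrite Rmult_0_l; apply exp_0|].
      rewrite S_INR, Rmult_plus_distr_r, exp_plus, IH, Rmult_1_l. simpl. ring. }
    assert (Q : forall n, 0 < exp (- (a n * p)) < 1).
    { intro n. split; [apply exp_pos|]. rewrite <- exp_0. apply exp_increasing.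
      pose proof (P n). assert (0 < a n * p) by (apply Rmult_lt_0_compat; lra). lra. }
    assert (L : is_lim_seq (fun j => Series (fun n => rpow (Cmod (decay a (INR j) y n)) p)) 0).
    { apply dominated_Series_lim0 with (fun n => rpow (Cmod (y n)) p); auto.
      - intros j n. split; [apply rpow_ge0|]. apply rpow_le; [lra|].
        rewrite <- (Rmult_1_l (Cmod (y n))). apply decay_le; auto. apply pos_INR.
      - intro n. apply is_lim_seq_ext with (fun j => rpow (Cmod (y n)) p * exp (- (a n * p)) ^ j).
        + intro j. rewrite E. ring.
        + replace (Finite 0) with (Rbar_mult (rpow (Cmod (y n)) p) 0) by (simpl; f_equal; ring).
          apply is_lim_seq_scal_l, is_lim_seq_geom. specialize (Q n). rewrite Rabs_pos_eq; lra. }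
    assert (He' : 0 < rpow eps p) by (rewrite rpow_pos by auto; apply exp_pos).
    apply is_lim_seq_spec in L. destruct (L (mkposreal _ He')) as [j Hj].
    specialize (Hj j (le_n _)). simpl in Hj. rewrite Rminus_0_r in Hj. apply Rabs_def2 in Hj.
    exists (INR j). split; [apply pos_INR|]. intros t Ht.
    destruct (decay_norm (Lp p) a y (INR j)) as [Ij _]; auto; [exact I|apply pos_INR|].
    destruct (solid_le (Lp p) 1 (decay a t y) (decay a (INR j) y)) as [_ N]; auto; [exact I|lra| |].
    { intro n. rewrite Rmult_1_l. apply decay_Cmod_le; auto. }
    eapply Rle_lt_trans; [exact N|]. rewrite Rmult_1_l. simpl.
    rewrite <- (rpow_rpow_inv eps p) by lra.
    apply rpow_lt; [apply Rinv_0_lt_compat; lra|]. split; [|lra].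
    apply Series_nonneg; auto. intro; apply rpow_ge0.
Qed.

Lemma setting_asym_stable (X : space) (a : nat -> R) (b : nat -> C) (S : R) :
  valid_space X -> X = C0 \/ (exists p, X = Lp p) -> setting a b S ->
  asym_stable X (Tk a b (k_ma a b)).
Proof.
  intros V HX H. pose proof (set_J _ _ _ H) as HJ. pose proof (set_S _ _ _ H) as HS.
  assert (Sol : solid X) by (destruct HX as [->|[p ->]]; exact I).
  split; [now apply setting_stable with S|]. intros x Sx eps He.
  assert (I0 : inX X (x 0)) by (apply Sx; lra).
  destruct (schur_bounded (Jker a b) S X (x 0)) as [Iy _]; auto.
  assert (He' : 0 < eps / S) by now apply Rdiv_lt_0_compat.
  destruct (decay_tendsto_0 X a _ V HX (set_decr _ _ _ H) (set_pos _ _ _ H) Iy _ He') as (t0 & P0 & Ht0).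
  exists t0. intros t Ht. rewrite (solution_flow X a b S x t) by (auto; lra).
  destruct (decay_norm X a (kmul (Jker a b) (x 0)) t) as [Id _]; auto; [apply H|lra|].
  destruct (schur_bounded (Jker a b) S X _ V Sol HS HJ Id) as [_ Nf].
  eapply Rle_lt_trans; [exact Nf|].
  replace eps with (S * (eps / S)) by (field; lra). apply Rmult_lt_compat_l; auto.
Qed.

Lemma setting_not_asym_stable (X : space) (a : nat -> R) (b : nat -> C) (S : R) :
  X = Linf \/ X = Cc -> setting a b S -> ~ asym_stable X (Tk a b (k_ma a b)).
Proof.
  intros HX H [_ A].
  assert (V : valid_space X) by (destruct HX as [->| ->]; exact I).
  set (x0 := fun _ : nat => RtoC 1).
  assert (I0 : inX X x0).
  { destruct HX as [->| ->].
    - exists 1. intro n. unfold x0. rewrite Cmod_1. lra.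
    - exists (RtoC 1). apply (cconv_eventually _ _ 0). auto. }
  assert (B0 : bounded_seq x0) by now apply inX_bounded with X.
  destruct (A _ (flow_solution X a b x0 S V H I0) (1 / 2)) as [t0 Ht0]; [lra|].
  set (t := Rmax t0 0). specialize (Ht0 t (Rmax_l _ _)).
  assert (Ht : 0 <= t) by apply Rmax_r.
  (* At this single time some coordinate lies within 1/2 of 1, so its modulus exceeds 1/2, against
     the supposed norm below 1/2. *)
  pose proof (cconv0_Cmod _ (flow_minus_C0 a b x0 S t H B0 Ht)) as L.
  apply is_lim_seq_spec in L. assert (e2 : 0 < 1 / 2) by lra.
  destruct (L (mkposreal _ e2)) as [n Hn]. specialize (Hn n (le_n _)). simpl in Hn.
  rewrite Rminus_0_r, Rabs_pos_eq in Hn by apply Cmod_ge_0.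
  pose proof (Cmod_le_normX X (flow a b x0 t) n V (flow_inX X a b x0 S t V H I0 Ht)) as N.
  pose proof (Cmod_triangle (flow a b x0 t n) (- (flow a b x0 t n - x0 n))%C) as T.
  replace (flow a b x0 t n + - (flow a b x0 t n - x0 n))%C with (RtoC 1) in T by (unfold x0; ring).
  rewrite Cmod_opp, Cmod_1 in T. lra.
Qed.

Theorem theorem4 (X : space) (a : nat -> R) (b : nat -> C) :
  valid_space X -> standing X a b -> pi_in_linf a -> spatially_exp_decays a b ->
  in_l1 (k_ma a b) /\
  ((X = C0 \/ exists p, X = Lp p) -> asym_stable X (Tk a b (k_ma a b))) /\
  ((X = Linf \/ X = Cc) ->
     stable X (Tk a b (k_ma a b)) /\ ~ asym_stable X (Tk a b (k_ma a b))).
Proof.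
  intros V St Hpi Hdec.
  destruct (setting_intro X a b V St Hpi Hdec) as [S H].
  split; [apply H|]. split.
  - intro HX. now apply setting_asym_stable with S.
  - intro HX. split; [now apply setting_stable with S|now apply setting_not_asym_stable with S].
Qed.
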